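(* Let $(U_n)$ be the signal process and let $\{V_n^{(k)}\}_{k=1}^K$ be either the EAKF or the ETKF ensemble as described in the context, with observation matrix $H\in\mathbb{R}^{q\times d}$, $\mathrm{rank}(H)=q\le d$. Assume that the signal satisfies the observable energy criterion: there exist $\beta_h\in(0,1)$ and $K_h>0$ such that $$|H\Psi_h(u)|^2+\mathrm{tr}(HR_h(u)H^T)\le (1-\beta_h)|Hu|^2+K_h\qquad\text{for all }u\in\mathbb{R}^d .$$ Then: (i) The observable posterior covariance satisfies $HC_nH^T\preceq I_q$ a.s. (for $n\ge1$), where $$C_n:=\frac1K\sum_{k=1}^K(V_n^{(k)}-\overline V_n)\otimes(V_n^{(k)}-\overline V_n).$$ (ii) There exist constants $D,M>0$ such that the ensemble mean $\overline V_n=\frac1K\sum_{k=1}^KV_n^{(k)}$ satisfies $$\mathbb{E}_{n-1}\big(|H\overline V_n|^2+M|HU_n|^2\big)\le\big(1-\tfrac12\beta_h\big)\big(|H\overline V_{n-1}|^2+M|HU_{n-1}|^2\big)+D$$ for all integers $n\ge2$. In particular, the function $$\mathcal{E}(U,V^{(1)},\dots,V^{(K)})=\sum_{k=1}^K|HV^{(k)}|^2+KM|HU|^2$$ is a Lyapunov function for the signal-ensemble process $(U_n,V_n^{(1)},\dots,V_n^{(K)})$, and hence the process is $\mathcal{E}$-bounded. (iii) When $\mathrm{rank}(H)=d$, $\mathcal{E}$ is a strong Lyapunov function and $$\mathbb{E}|U_n|^2+\sum_{k=1}^K\mathbb{E}|V_n^{(k)}|^2$$ is bounded uniformly in $n\ge0$.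 The precise bound can be read off from the Grönwall bound for Lyapunov functions recalled in the context. (iv) The claims above hold for any choice of positive semi-definite covariance matrix $\widehat C_n$ in the assimilation steps, in particular for uniform covariance inflation ($\widehat C_n$ replaced by $(1+\lambda)\widehat C_n$, $\lambda>0$).
   Context: Signal and observations. Fix $h>0$, integers $1\le q\le d$, $K\ge2$, and $H\in\mathbb{R}^{q\times d}$ of rank $q$. $\Psi_h:\mathbb{R}^d\to\mathbb{R}^d$ is a (nonlinear) map. The signal in $\mathbb{R}^d$ and observation in $\mathbb{R}^q$ are $$U_n=\Psi_h(U_{n-1})+\zeta_n,\qquad Z_n=HU_n+\xi_n .$$ Given the past up to time $n-1$, the law of $\zeta_n$ depends only on $U_{n-1}$; given $U_{n-1}=u$ it has mean $0$ and covariance matrix $R_h(u)$. The $\xi_n$ are i.i.d. noises with mean $0$ and covariance $I_q$, independent of the signal. Ensemble square root filters (ETKF, EAKF). The initial ensemble is, for instance, sampled from the equilibrium distribution of $U_n$. Given $\{V_{n-1}^{(k)}\}_{k=1}^K\subset\mathbb{R}^d$: Forecast: $\widehat V_n^{(k)}=\Psi_h(V_{n-1}^{(k)})+\zeta_n^{(k)}$, where the $\zeta_n^{(k)}$ are independent samples of the system noise, $\zeta_n^{(k)}$ having the conditional law that $\zeta_n$ has given $U_{n-1}=V_{n-1}^{(k)}$. Put $\overline{\widehat V}_n=\frac1K\sum_k\widehat V_n^{(k)}$, $\widehat S_n=[\widehat V_n^{(1)}-\overline{\widehat V}_n,\dots,\widehat V_n^{(K)}-\overline{\widehat V}_n]\in\mathbb{R}^{d\times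 K}$ and $\widehat C_n=\frac1{K-1}\widehat S_n\widehat S_n^T$. Assimilation step for the mean: $\overline V_n=\overline{\widehat V}_n-\widehat C_nH^T(I+H\widehat C_nH^T)^{-1}(H\overline{\widehat V}_n-Z_n)$. Assimilation step for the spread: the posterior spread is a $d\times K$ matrix $S_n$, of the form $S_n=\widehat S_nT_n$ with $T_n\in\mathbb{R}^{K\times K}$ (ETKF) or $S_n=A_n\widehat S_n$ with $A_n\in\mathbb{R}^{d\times d}$ (EAKF), where $T_n$ or $A_n$ is chosen so that $$\tfrac1{K-1}S_nS_n^T=\widehat C_n-\widehat C_nH^T(H\widehat C_nH^T+I)^{-1}H\widehat C_n .$$ The ensemble is updated to $V_n^{(k)}=\overline V_n+S_n^{(k)}$, with $S_n^{(k)}$ the $k$-th column of $S_n$; the columns of $S_n$ sum to zero, so that $\overline V_n$ is the mean of the $V_n^{(k)}$. The process $(U_n,V_n^{(1)},\dots,V_n^{(K)})$ is a Markov chain; $\mathcal{F}_n=\sigma\{U_m,V_m^{(1)},\dots,V_m^{(K)}:m\le n\}$ and $\mathbb{E}_n$ is conditional expectation given $\mathcal{F}_n$. $A\preceq B$ means $B-A$ is positive semi-definite, and $a\otimes a=aa^T$. Lyapunov functions. A function $\mathcal{E}\ge0$ is a Lyapunov function for a Markov chain $X_n$ if there are constants $\beta\in(0,1)$, $c>0$ with $\mathbb{E}(\mathcal{E}(X_n)\mid X_{n-1})\le(1-\beta)\mathcal{E}(X_{n-1})+c$ for all integers $n\ge1$. It is strong if its sub-level sets are compact. By Grönwall's inequality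 a Lyapunov function satisfies $\mathbb{E}\mathcal{E}(X_n)\le(1-\beta)^n\mathbb{E}\mathcal{E}(X_0)+c/\beta$, so $\mathbb{E}\mathcal{E}(X_n)$ can be bounded uniformly in time; in this case $X_n$ is called $\mathcal{E}$-bounded.
   Formalization: E-boundedness in (ii) is stated assuming the initial expectation of E is finite, and the uniform second-moment bound in (iii) assuming finite second moments at n=0; without these both fail already at n=0. *)

(* Defs.v *)
From HB Require Import structures.
From mathcomp Require Import all_boot all_order all_algebra.
From mathcomp Require Import all_classical all_reals all_analysis.
From mathcomp Require Import measurable_realfun.

Set Implicit Arguments.
Unset Strict Implicit.
Unset Printing Implicit Defensive.
Import Order.TTheory GRing.Theory Num.Theory.
Import numFieldNormedType.Exports.

Local Open Scope classical_set_scope.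
Local Open Scope ring_scope.

Section LinearAlgebra.
Variable R : realType.

Definition sqnorm (n : nat) (v : 'cV[R]_n) : R := \sum_(i < n) v i 0 ^+ 2.

Definition psd (n : nat) (A : 'M[R]_n) : Prop :=
  A^T = A /\ forall v : 'cV[R]_n, 0 <= (v^T *m A *m v) 0 0.

Definition loewner_le (n : nat) (A B : 'M[R]_n) : Prop := psd (B - A).

(** An ensemble is a [d x K] matrix whose columns are its members. *)
Definition ens_mean (d K : nat) (V : 'M[R]_(d, K)) : 'cV[R]_d :=
  K%:R^-1 *: \sum_(k < K) col k V.

Definition spread (d K : nat) (V : 'M[R]_(d, K)) : 'M[R]_(d, K) :=
  \matrix_(i, k) (V i k - ens_mean V i 0).

Definition sample_cov (d K : nat) (V : 'M[R]_(d, K)) : 'M[R]_d :=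
  K.-1%:R^-1 *: (spread V *m (spread V)^T).

(** Normalised by [1/K], unlike [sample_cov]. *)
Definition post_cov (d K : nat) (V : 'M[R]_(d, K)) : 'M[R]_d :=
  K%:R^-1 *: \sum_(k < K)
    ((col k V - ens_mean V) *m (col k V - ens_mean V)^T).

End LinearAlgebra.

HB.instance Definition _ (S S' : ptopologicalType) :=
  Pointed.on (S * S')%type.

Section Probability.

Definition borel (S : ptopologicalType) := g_sigma_algebraType (@open S).

Definition centered_cov (R : realType) (n : nat)
    (mu : {measure set (borel 'cV[R]_n) -> \bar R}) (C : 'M[R]_n) : Prop :=
  (forall i, mu.-integrable setT (fun x : borel 'cV[R]_n => (x i 0)%:E) /\
     (\int[mu]_x (x i 0)%:E = 0)%E) /\
  (forall i j,
     mu.-integrable setT (fun x : borel 'cV[R]_n => (x i 0 * x j 0)%:E) /\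
     (\int[mu]_x (x i 0 * x j 0)%:E = (C i j)%:E)%E).

Context (disp : measure_display) (T : measurableType disp) (R : realType).
Variable P : probability T R.

(** [Z] is a version of the conditional expectation, given the sigma-algebra
    [G], of the non-negative (possibly non-integrable) variable [Y]. *)
Definition is_condexp (G : set (set T)) (Y Z : T -> \bar R) : Prop :=
  [/\ measurable_fun setT (Z : g_sigma_algebraType G -> \bar R),
      forall w, (0 <= Z w)%E &
      forall A, G A -> (\int[P]_(w in A) Z w = \int[P]_(w in A) Y w)%E].

(** The default value [+oo] makes an upper bound on [condexp G Y] entail that
    a version exists. *)
Definition condexp (G : set (set T)) (Y : T -> \bar R) : T -> \bar R :=
  xget (fun=> +oo%E) [set Z | is_condexp G Y Z].

Definition sigma_of (S : ptopologicalType) (X : T -> S) : set (set T) :=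
  preimage_set_system setT (X : T -> borel S) measurable.

Definition sigma_family (S : ptopologicalType) (X : nat -> T -> S)
    (I : set nat) : set (set T) :=
  <<s \bigcup_(m in I) sigma_of (X m) >>.

Definition past (S : ptopologicalType) (X : nat -> T -> S) (n : nat) :=
  sigma_family X [set m | (m <= n)%N].

Definition drift_condition (S : ptopologicalType) (X : nat -> T -> S)
    (E : S -> R) (beta c : R) : Prop :=
  forall n, (1 <= n)%N ->
    {ae P, forall w,
      (condexp (sigma_of (X n.-1)) (fun w' => (E (X n w'))%:E) w
       <= ((1 - beta) * E (X n.-1 w) + c)%:E)%E}.

Definition lyapunov (S : ptopologicalType) (X : nat -> T -> S) (E : S -> R)
    : Prop :=
  (forall x, 0 <= E x) /\
  exists beta c, [/\ 0 < beta < 1, 0 < c & drift_condition X E beta c].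

Definition strong_lyapunov (S : ptopologicalType) (X : nat -> T -> S)
    (E : S -> R) : Prop :=
  lyapunov X E /\ forall a : R, compact [set x | E x <= a].

Definition E_bounded (S : ptopologicalType) (X : nat -> T -> S) (E : S -> R)
    : Prop :=
  exists B : R, forall n, ('E_P[fun w => E (X n w)] <= B%:E)%E.

End Probability.

Section Filter.
Context (disp : measure_display) (T : measurableType disp) (R : realType).
Variables (P : probability T R) (d q K : nat) (H : 'M[R]_(q, d)).

Definition state : ptopologicalType := ('cV[R]_d * 'M[R]_(d, K))%type.

Definition chain (U : nat -> T -> 'cV[R]_d) (V : nat -> T -> 'M[R]_(d, K))
  (n : nat) (w : T) : state := (U n w, V n w).

Definition observation (U : nat -> T -> 'cV[R]_d) (xi : nat -> T -> 'cV[R]_q)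
  (n : nat) (w : T) : 'cV[R]_q := H *m U n w + xi n w.

(** The forecast ensemble at time [n], meaningful for [1 <= n]. *)
Definition forecast (Psi : 'cV[R]_d -> 'cV[R]_d)
    (V : nat -> T -> 'M[R]_(d, K)) (zetaV : nat -> 'I_K -> T -> 'cV[R]_d)
    (n : nat) (w : T) : 'M[R]_(d, K) :=
  \matrix_(i, k) (Psi (col k (V n.-1 w)) + zetaV n k w) i 0.

Record signal_noise_model (Psi : 'cV[R]_d -> 'cV[R]_d)
    (Rh : 'cV[R]_d -> 'M[R]_d)
    (law : nat -> R.-pker (borel 'cV[R]_d) ~> (borel 'cV[R]_d))
    (law_xi : probability (borel 'cV[R]_q) R)
    (U : nat -> T -> 'cV[R]_d) (V : nat -> T -> 'M[R]_(d, K))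
    (zeta : nat -> T -> 'cV[R]_d) (zetaV : nat -> 'I_K -> T -> 'cV[R]_d)
    (xi : nat -> T -> 'cV[R]_q) : Prop := {
  measurable_Psi :
    measurable_fun setT (Psi : borel 'cV[R]_d -> borel 'cV[R]_d);
  measurable_chain : forall n,
    measurable_fun setT (chain U V n : T -> borel state);
  measurable_zeta : forall n,
    measurable_fun setT (zeta n.+1 : T -> borel 'cV[R]_d);
  measurable_zetaV : forall n k,
    measurable_fun setT (zetaV n.+1 k : T -> borel 'cV[R]_d);
  measurable_xi : forall n,
    measurable_fun setT (xi n.+1 : T -> borel 'cV[R]_q);
  signal_dynamics : forall n,
    {ae P, forall w, U n.+1 w = Psi (U n w) + zeta n.+1 w};
  law_moments : forall n u, centered_cov (law n.+1 u) (Rh u);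
  law_xi_moments : centered_cov law_xi 1%:M;
  (** Given the past up to time [n], the noises at time [n.+1] are independent;
      the signal noise and the [k]-th ensemble noise have conditional laws
      [law n.+1 (U n)] and [law n.+1 (V n)^(k)], and the observation noise has
      law [law_xi]. *)
  noise_conditional_law : forall n (B0 : set (borel 'cV[R]_d))
      (B : 'I_K -> set (borel 'cV[R]_d)) (B1 : set (borel 'cV[R]_q)),
    measurable B0 -> (forall k, measurable (B k)) -> measurable B1 ->
    is_condexp P (past (chain U V) n)
      (fun w => (\1_([set w' | [/\ B0 (zeta n.+1 w'),
                                   forall k, B k (zetaV n.+1 k w') &
                                   B1 (xi n.+1 w')]]) w)%:E)
      (fun w => (law n.+1 (U n w) B0
                 * (\big[*%E/1%E]_(k < K) law n.+1 (col k (V n w)) (B k))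
                 * law_xi B1)%E);
  (** The [xi n], [1 <= n], are i.i.d. and independent of the signal. *)
  xi_iid_indep_signal : forall N (A : set T)
      (B : 'I_N -> set (borel 'cV[R]_q)),
    sigma_family U setT A -> (forall i, measurable (B i)) ->
    P (A `&` [set w | forall i : 'I_N, B i (xi i.+1 w)]) =
      (P A * \big[*%E/1%E]_(i < N) law_xi (B i))%E }.

Inductive esrf_kind := ETKF | EAKF.

Definition spread_form (kind : esrf_kind) (Shat S : 'M[R]_(d, K)) : Prop :=
  match kind with
  | ETKF => exists A : 'M[R]_K, S = Shat *m A
  | EAKF => exists A : 'M[R]_d, S = A *m Shat
  end.

Definition mean_update (C : 'M[R]_d) (m : 'cV[R]_d) (z : 'cV[R]_q)
    : 'cV[R]_d :=
  m - C *m H^T *m invmx (1%:M + H *m C *m H^T) *m (H *m m - z).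

Definition cov_update (C : 'M[R]_d) : 'M[R]_d :=
  C - C *m H^T *m invmx (H *m C *m H^T + 1%:M) *m H *m C.

(** One assimilation step, from the forecast ensemble [Vf] to the posterior
    ensemble [V], given the observation [z] and the prior covariance [C]. *)
Definition assimilation (kind : esrf_kind) (C : 'M[R]_d)
    (Vf : 'M[R]_(d, K)) (z : 'cV[R]_q) (V : 'M[R]_(d, K)) : Prop :=
  exists S : 'M[R]_(d, K),
    [/\ spread_form kind (spread Vf) S,
        K.-1%:R^-1 *: (S *m S^T) = cov_update C,
        \sum_(k < K) col k S = 0 &
        forall k, col k V = mean_update C (ens_mean Vf) z + col k S].

(** [C n w] is the prior covariance used by the assimilation at time [n]. *)
Definition esrf (kind : esrf_kind) (Psi : 'cV[R]_d -> 'cV[R]_d)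
    (C : nat -> T -> 'M[R]_d) (U : nat -> T -> 'cV[R]_d)
    (V : nat -> T -> 'M[R]_(d, K)) (zetaV : nat -> 'I_K -> T -> 'cV[R]_d)
    (xi : nat -> T -> 'cV[R]_q) : Prop :=
  forall n, (1 <= n)%N ->
    {ae P, forall w,
      assimilation kind (C n w) (forecast Psi V zetaV n w)
        (observation U xi n w) (V n w)}.

Definition observable_energy_criterion (Psi : 'cV[R]_d -> 'cV[R]_d)
    (Rh : 'cV[R]_d -> 'M[R]_d) (beta K_h : R) : Prop :=
  forall u : 'cV[R]_d,
    sqnorm (H *m Psi u) + \tr (H *m Rh u *m H^T)
      <= (1 - beta) * sqnorm (H *m u) + K_h.

Definition mean_energy (M : R) (x : state) : R :=
  sqnorm (H *m ens_mean x.2) + M * sqnorm (H *m x.1).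

Definition ensemble_energy (M : R) (x : state) : R :=
  \sum_(k < K) sqnorm (H *m col k x.2) + K%:R * M * sqnorm (H *m x.1).

Definition second_moment (U : nat -> T -> 'cV[R]_d)
    (V : nat -> T -> 'M[R]_(d, K)) (n : nat) : \bar R :=
  ('E_P[fun w => sqnorm (U n w)]
   + \sum_(k < K) 'E_P[fun w => sqnorm (col k (V n w))])%E.

Definition observable_stability (beta_h : R) (U : nat -> T -> 'cV[R]_d)
    (V : nat -> T -> 'M[R]_(d, K)) : Prop :=
  let X := chain U V in
  (forall n, (1 <= n)%N ->
     {ae P, forall w, loewner_le (H *m post_cov (V n w) *m H^T) 1%:M}) /\
  exists D M : R, [/\ 0 < D, 0 < M,
    forall n, (2 <= n)%N ->
      {ae P, forall w,
        (condexp P (past X n.-1) (fun w' => (mean_energy M (X n w'))%:E) w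
         <= ((1 - beta_h / 2) * mean_energy M (X n.-1 w) + D)%:E)%E},
    lyapunov P X (ensemble_energy M) /\
      (('E_P[fun w => ensemble_energy M (X 0%N w)] < +oo)%E ->
       E_bounded P X (ensemble_energy M)) &
    \rank H = d ->
      [/\ strong_lyapunov P X (ensemble_energy M),
          (second_moment U V 0 < +oo)%E ->
            exists B : R, forall n, (second_moment U V n <= B%:E)%E &
          (** The explicit bound given by Groenwall's inequality. *)
          exists a beta c : R, [/\ 0 < a, 0 < beta < 1, 0 < c,
            drift_condition P X (ensemble_energy M) beta c &
            forall n, (second_moment U V n <=
              a%:E * (((1 - beta) ^+ n)%:E *
                        'E_P[fun w => ensemble_energy M (X 0%N w)]
                      + (c / beta)%:E))%E]]].

End Filter.

(* Main.v *)
Require Import Defs.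
From HB Require Import structures.
From mathcomp Require Import all_boot all_order all_algebra.
From mathcomp Require Import all_classical all_reals all_analysis.
From mathcomp Require Import measurable_realfun.
From mathcomp Require Import ring lra.

(** Write [A = H C H^T]. The observed posterior covariance is
    [1 - (1 + A)^-1], which is at most the identity; and the observed posterior
    mean [x] solves [x - H m = A (z - x)], so it lies in the ball with diameter
    [[H m, z]], whence the pathwise bound [|x|^2 <= |H m|^2 + |z|^2] whatever
    [A] is, even a random [A] that depends on the noises. By Jensen,
    [|H m|^2] is at most the average of the observed energies of the forecast
    members, and each of these, as well as the signal, satisfies the observable
    energy criterion in conditional mean. The average observed energy of the
    previous ensemble exceeds that of its mean by at most [q], by the
    covariance bound.

    Nothing is assumed integrable at time [0], so conditional expectations are
    those of non-negative variables, obtained by slicing and Radon-Nikodym, and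
    they are compared through integrals over the events of the past. *)

Set Implicit Arguments.
Unset Strict Implicit.
Unset Printing Implicit Defensive.
Import Order.TTheory GRing.Theory Num.Theory.
Import numFieldNormedType.Exports.

Local Open Scope classical_set_scope.
Local Open Scope ring_scope.

(** * The assimilation step *)

Section SquaredNorm.
Variable R : realType.

Definition dotv n (u v : 'cV[R]_n) : R := \sum_(i < n) u i 0 * v i 0.

Lemma dotvE n (u v : 'cV[R]_n) : dotv u v = (u^T *m v) 0 0.
Proof. by rewrite mxE; apply: eq_bigr => i _; rewrite mxE. Qed.

Lemma dotvC n (u v : 'cV[R]_n) : dotv u v = dotv v u.
Proof. by apply: eq_bigr => i _; rewrite mulrC. Qed.

Lemma dotvDl n (u v w : 'cV[R]_n) : dotv (u + v) w = dotv u w + dotv v w.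
Proof. by rewrite -big_split; apply: eq_bigr => i _; rewrite mxE mulrDl. Qed.

Lemma dotvNl n (u w : 'cV[R]_n) : dotv (- u) w = - dotv u w.
Proof. by rewrite -sumrN; apply: eq_bigr => i _; rewrite mxE mulNr. Qed.

Lemma dotvDr n (u v w : 'cV[R]_n) : dotv w (u + v) = dotv w u + dotv w v.
Proof. by rewrite dotvC dotvDl !(dotvC w). Qed.

Lemma dotvNr n (u w : 'cV[R]_n) : dotv w (- u) = - dotv w u.
Proof. by rewrite dotvC dotvNl dotvC. Qed.

Lemma dotv0 n (w : 'cV[R]_n) : dotv w 0 = 0.
Proof. by rewrite dotvE mulmx0 mxE. Qed.

Lemma dotv_sumr n I (r : seq I) (u : I -> 'cV[R]_n) w :
  dotv w (\sum_(i <- r) u i) = \sum_(i <- r) dotv w (u i).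
Proof. by rewrite dotvE mulmx_sumr summxE; under [RHS]eq_bigr do rewrite dotvE. Qed.

Lemma dotvv n (u : 'cV[R]_n) : dotv u u = sqnorm u.
Proof. by apply: eq_bigr => i _; rewrite expr2. Qed.

Lemma sqnorm_ge0 n (v : 'cV[R]_n) : 0 <= sqnorm v.
Proof. by apply: sumr_ge0 => i _; exact: sqr_ge0. Qed.

Lemma sqnorm_eq0 n (v : 'cV[R]_n) : sqnorm v = 0 -> v = 0.
Proof.
move=> /eqP; rewrite psumr_eq0; last by move=> i _; exact: sqr_ge0.
move=> /allP v0; apply/colP => i; rewrite mxE.
by have := v0 i (mem_index_enum _); rewrite sqrf_eq0 => /eqP.
Qed.

Lemma sqnormD n (u v : 'cV[R]_n) :
  sqnorm (u + v) = sqnorm u + 2 * dotv u v + sqnorm v.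
Proof. rewrite -!dotvv !dotvDl !dotvDr (dotvC v u); ring. Qed.

Lemma sqnormD_le n (u v : 'cV[R]_n) :
  sqnorm (u + v) <= 2 * sqnorm u + 2 * sqnorm v.
Proof.
have := sqnorm_ge0 (u - v).
by rewrite sqnormD sqnormD dotvNr -(dotvv (- v)) dotvNl dotvNr dotvv; lra.
Qed.

Lemma sqnorm_coord_le n (v : 'cV[R]_n) i : v i 0 ^+ 2 <= sqnorm v.
Proof.
rewrite /sqnorm (bigD1 i) //= lerDl; apply: sumr_ge0 => j _; exact: sqr_ge0.
Qed.

(** Cauchy-Schwarz on each row: the constant is the sum of the squared entries of [A], plus 1 to
    make it positive. It is applied both to [H] and to a left inverse of [H]. *)
Lemma sqnorm_mulmx_le m n (A : 'M[R]_(m, n)) :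
  exists2 a : R, 0 < a & forall v, sqnorm (A *m v) <= a * sqnorm v.
Proof.
have cs p (x y : 'cV[R]_p) : dotv x y ^+ 2 <= sqnorm x * sqnorm y.
  have [->|y0] := eqVneq y 0.
    by rewrite dotv0 expr0n mulr_ge0 // sqnorm_ge0.
  have y1 : 0 < sqnorm y.
    by rewrite lt_neqAle sqnorm_ge0 andbT eq_sym;
      apply: contra_neq y0 => /sqnorm_eq0.
  (* The squared norm of this vector equals [|y|^2 (|x|^2 |y|^2 - <x, y>^2)]. *)
  have := sqnorm_ge0 (sqnorm y *: x - dotv x y *: y).
  have sqz (c : R) (u : 'cV[R]_p) : sqnorm (c *: u) = c ^+ 2 * sqnorm u.
    by rewrite /sqnorm mulr_sumr; apply: eq_bigr => i _; rewrite mxE exprMn.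
  have dz (c : R) (u v : 'cV[R]_p) : dotv (c *: u) v = c * dotv u v.
    by rewrite /dotv mulr_sumr; apply: eq_bigr => i _; rewrite mxE mulrA.
  rewrite sqnormD dotvNr -(dotvv (- _)) dotvNl dotvNr opprK dotvv !sqz.
  rewrite dz (dotvC x) dz (dotvC y x).
  rewrite (_ : _ + _ = sqnorm y * (sqnorm x * sqnorm y - dotv x y ^+ 2));
    last by ring.
  by rewrite pmulr_rge0 // subr_ge0.
exists (1 + \sum_i sqnorm (row i A)^T).
  by rewrite ltr_pwDl // sumr_ge0 // => i _; exact: sqnorm_ge0.
move=> v; rewrite mulrDl mul1r mulr_suml.
apply: (@le_trans _ _ (\sum_i sqnorm (row i A)^T * sqnorm v)); last first.
  by rewrite lerDr sqnorm_ge0.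
apply: ler_sum => i _; apply: le_trans (cs _ _ _).
by rewrite dotvE trmxK -row_mul [X in _ <= X ^+ 2]mxE.
Qed.

End SquaredNorm.

(** * Positive semi-definite matrices *)

Section PositiveSemidefinite.
Variable R : realType.

Lemma psd_congr m n (A : 'M[R]_n) (B : 'M[R]_(m, n)) :
  psd A -> psd (B *m A *m B^T).
Proof.
move=> [As A0]; split; first by rewrite !trmx_mul trmxK As mulmxA.
by move=> v; have := A0 (B^T *m v); rewrite trmx_mul trmxK !mulmxA.
Qed.

Lemma psd_gram m n (B : 'M[R]_(m, n)) : psd (B *m B^T).
Proof.
rewrite -[B in B *m _]mulmx1; apply: psd_congr.
split=> [|v]; first exact: trmx1.
by rewrite mulmx1 -dotvE dotvv sqnorm_ge0.
Qed.

Lemma psdZ n (a : R) (A : 'M[R]_n) : 0 <= a -> psd A -> psd (a *: A).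
Proof.
move=> a0 [As A0]; split=> [|v]; first by rewrite linearZ /= As.
by rewrite -scalemxAr -scalemxAl mxE mulr_ge0.
Qed.

Lemma psdD n (A B : 'M[R]_n) : psd A -> psd B -> psd (A + B).
Proof.
move=> [As A0] [Bs B0]; split=> [|v]; first by rewrite linearD /= As Bs.
by rewrite mulmxDr mulmxDl mxE addr_ge0.
Qed.

Lemma psd1 n : psd (1%:M : 'M[R]_n).
Proof. by have := psd_gram (1%:M : 'M[R]_n); rewrite mul1mx trmx1. Qed.

(** A row [u] of the kernel satisfies [u A u^T + |u|^2 = 0] with both terms non-negative, hence
    vanishes. *)
Lemma psd_add1_unitmx n (A : 'M[R]_n) : psd A -> A + 1%:M \in unitmx.
Proof.
move=> [As A0]; rewrite -row_free_unit -kermx_eq0; apply/eqP/row_matrixP => i.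
rewrite row0; set u := row i _.
have u0 : u *m (A + 1%:M) = 0 by rewrite -row_mul mulmx_ker row0.
clearbody u; have /(congr1 (fun M : 'M[R]_1 => M 0 0)) : u *m (A + 1%:M) *m u^T = 0.
  by rewrite u0 mul0mx.
rewrite mulmxDr mulmx1 mulmxDl !mxE.
have := A0 u^T; rewrite trmxK mxE => Au.
have -> : \sum_j u 0 j * u^T j 0 = sqnorm u^T.
  by apply: eq_bigr => j _; rewrite mxE expr2.
have := sqnorm_ge0 u^T => s0 e0.
have /sqnorm_eq0 : sqnorm u^T = 0 by lra.
by move/(congr1 trmx); rewrite trmxK trmx0.
Qed.

(** The inverse is congruent to [B]: by symmetry, [B^-1 = B^-1 B (B^-1)^T]. *)
Lemma psd_invmx n (B : 'M[R]_n) : B \in unitmx -> psd B -> psd (invmx B).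
Proof.
move=> Bu Bp; have := psd_congr (invmx B) Bp.
by rewrite mulVmx // mul1mx trmx_inv Bp.1.
Qed.

Lemma psd_trace_ge0 n (A : 'M[R]_n) : psd A -> 0 <= \tr A.
Proof.
move=> [_ A0]; apply: sumr_ge0 => i _.
have := A0 (delta_mx i 0).
rewrite trmx_delta -rowE -colE !mxE //.
Qed.

End PositiveSemidefinite.

(** * Algebra of the mean and covariance updates *)

Section Assimilation.
Variables (R : realType) (d q K : nat) (H : 'M[R]_(q, d)).

(** With [A = H C H^T], the updated observed mean [x] satisfies
    [x - H m = A (z - x)], so [x] lies in the ball with diameter
    [[H m, z]], whose points satisfy the bound. *)
Lemma mean_update_le (C : 'M[R]_d) m z : psd C ->
  sqnorm (H *m mean_update H C m z) <= sqnorm (H *m m) + sqnorm z.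
Proof.
move=> Cp; set x := H *m _; have Ap := psd_congr H Cp.
set A := H *m C *m H^T in Ap.
set y := invmx (1%:M + A) *m (H *m m - z).
have xE : x = H *m m - A *m y.
  by rewrite /x /mean_update mulmxBr /y /A !mulmxA.
have yE : y + A *m y = H *m m - z.
  rewrite -{1}[y]mul1mx -mulmxDl /y mulmxA mulmxV ?mul1mx //.
  by rewrite addrC psd_add1_unitmx.
have xz : x - z = y by rewrite xE addrAC -yE addrK.
have xm : H *m m - x = A *m y by rewrite xE subKr.
(* This inner product is [y^T A y]; its sign says that [x] sees the segment from [H m] to [z] under
   an angle that is at least right. *)
have : 0 <= dotv (x - z) (H *m m - x).
  by rewrite xz xm dotvE mulmxA; exact: Ap.2.
rewrite dotvDl dotvNl !dotvDr !dotvNr dotvv (dotvC z x) (dotvC z) (dotvC x (H *m m)).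
(* The claim is the identity [|H m|^2 + |z|^2 - |x|^2 = |H m + z - x|^2 + 2 <x - z, H m - x>]. *)
have := sqnorm_ge0 (H *m m + z - x).
rewrite -!dotvv !dotvDl !dotvDr !dotvNl !dotvNr (dotvC x) (dotvC z) (dotvC x z).
lra.
Qed.

(** With [B = (A + 1)^-1], both [A B] and [B A] equal [1 - B], so
    [A - A B A = A - (1 - B) A = B A = 1 - B]. *)
Lemma cov_update_obs (C : 'M[R]_d) : psd C ->
  H *m cov_update H C *m H^T = 1%:M - invmx (H *m C *m H^T + 1%:M).
Proof.
move=> Cp; have Ap := psd_congr H Cp.
rewrite /cov_update mulmxBr mulmxBl.
set A := H *m C *m H^T in Ap *; set B := invmx _.
have Bu := psd_add1_unitmx Ap.
have -> : H *m (C *m H^T *m B *m H *m C) *m H^T = A *m B *m A.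
  by rewrite /A !mulmxA.
have AB : A *m B = 1%:M - B.
  rewrite -[A in A *m _](addrK 1%:M) mulmxDl mulNmx mul1mx /B mulmxV //.
have BA : B *m A = 1%:M - B.
  rewrite -[A in _ *m A](addrK 1%:M) mulmxDr mulmxN mulmx1 /B mulVmx //.
by rewrite AB mulmxBl mul1mx BA subKr.
Qed.

Lemma ens_mean_dev (V : 'M[R]_(d, K)) : (0 < K)%N ->
  \sum_(k < K) (col k V - ens_mean V) = 0.
Proof.
move=> K0; rewrite big_split /= sumr_const card_ord /ens_mean -scaler_nat.
by rewrite scalerN scalerA divff ?scale1r ?subrr // pnatr_eq0 -lt0n.
Qed.

(** Mean-variance decomposition: the cross terms cancel because the deviations sum to zero. It
    yields Jensen's inequality for the ensemble mean by dropping the trace, and a converse up to [q]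
    by bounding it. *)
Lemma sum_sqnorm_obs (V : 'M[R]_(d, K)) : (0 < K)%N ->
  \sum_(k < K) sqnorm (H *m col k V) =
  K%:R * (sqnorm (H *m ens_mean V) + \tr (H *m post_cov V *m H^T)).
Proof.
move=> K0; have K1 : K%:R != 0 :> R by rewrite pnatr_eq0 -lt0n.
set m := ens_mean V.
have -> : \tr (H *m post_cov V *m H^T) =
    K%:R^-1 * \sum_(k < K) sqnorm (H *m (col k V - m)).
  rewrite /post_cov -scalemxAr -scalemxAl mxtraceZ mulmx_sumr mulmx_suml.
  rewrite raddf_sum /=; congr (_ * _); apply: eq_bigr => k _.
  rewrite mulmxA -(mulmxA (H *m _)) -trmx_mul mxtrace_mulC -dotvv dotvE.
  by rewrite /mxtrace big_ord1.
rewrite mulrDr mulrA divff // mul1r.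
have E k : sqnorm (H *m col k V) = sqnorm (H *m m)
    + 2 * dotv (H *m m) (H *m (col k V - m)) + sqnorm (H *m (col k V - m)).
  by rewrite -sqnormD -mulmxDr addrC subrK.
rewrite (eq_bigr _ (fun k _ => E k)).
rewrite !big_split /= sumr_const card_ord -[X in X + _ + _]mulr_natl.
rewrite -mulr_sumr -dotv_sumr -mulmx_sumr ens_mean_dev // mulmx0.
by rewrite dotv0 mulr0 addr0.
Qed.

Lemma psd_post_cov (V : 'M[R]_(d, K)) : psd (post_cov V).
Proof.
apply: psdZ; first by rewrite invr_ge0.
apply: big_ind => [| |k _]; [|exact: psdD|exact: psd_gram].
by have := psdZ (lexx 0) (psd1 R d); rewrite scale0r.
Qed.

Lemma sqnorm_ens_mean_le (V : 'M[R]_(d, K)) : (0 < K)%N ->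
  K%:R * sqnorm (H *m ens_mean V) <= \sum_(k < K) sqnorm (H *m col k V).
Proof.
move=> K0; rewrite sum_sqnorm_obs // ler_wpM2l // lerDl.
by apply: psd_trace_ge0; apply: psd_congr; exact: psd_post_cov.
Qed.

Lemma sum_sqnorm_le (V : 'M[R]_(d, K)) : (0 < K)%N ->
  loewner_le (H *m post_cov V *m H^T) 1%:M ->
  \sum_(k < K) sqnorm (H *m col k V) <=
  K%:R * (sqnorm (H *m ens_mean V) + q%:R).
Proof.
move=> K0 /psd_trace_ge0; rewrite raddfB /= mxtrace1 subr_ge0 => tq.
by rewrite sum_sqnorm_obs // ler_wpM2l // lerD2l.
Qed.

Lemma psd_sample_cov (V : 'M[R]_(d, K)) : psd (sample_cov V).
Proof. by apply: psdZ; [rewrite invr_ge0|exact: psd_gram]. Qed.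

Variables (kind : esrf_kind) (C : 'M[R]_d) (Vf V : 'M[R]_(d, K)) (z : 'cV[R]_q).
Hypotheses (K2 : (2 <= K)%N) (Cp : psd C) (asm : assimilation H kind C Vf z V).

Lemma assimilation_mean : ens_mean V = mean_update H C (ens_mean Vf) z.
Proof.
case: asm => S [_ _ S0 VS]; rewrite /ens_mean (eq_bigr _ (fun k _ => VS k)).
rewrite big_split /= S0 addr0 sumr_const card_ord -[X in _ *: X]scaler_nat scalerA.
by rewrite mulVf ?scale1r // pnatr_eq0; case: K K2.
Qed.

(** The assimilation prescribes the covariance normalised by [1/(K-1)], whereas [post_cov] is
    normalised by [1/K]; the ratio [a = (K-1)/K] lies in [[0, 1]], so the bound on the former passes
    to the latter. *)
Lemma assimilation_post_cov : loewner_le (H *m post_cov V *m H^T) 1%:M.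
Proof.
have eqm := assimilation_mean; case: asm => S [_ SC S0 VS].
have K1 : K.-1%:R != 0 :> R by rewrite pnatr_eq0; case: K K2 => [|[]].
have SS : S *m S^T = K.-1%:R *: cov_update H C.
  by rewrite -SC scalerA divff // scale1r.
have -> : post_cov V = (K%:R^-1 * K.-1%:R) *: cov_update H C.
  rewrite -scalerA -SS /post_cov; congr (_ *: _).
  under eq_bigr => k _ do rewrite eqm VS addrAC subrr add0r.
  apply/matrixP => i j; rewrite summxE mxE; apply: eq_bigr => k _.
  by rewrite !mxE big_ord1 !mxE.
rewrite /loewner_le -scalemxAr -scalemxAl cov_update_obs //.
set B := H *m C *m H^T + 1%:M; have Bu : B \in unitmx by exact/psd_add1_unitmx/psd_congr.
have Bp : psd B by apply: psdD (psd1 _ _); exact: psd_congr.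
set a := _ * _.
have a0 : 0 <= a by rewrite mulr_ge0 // invr_ge0.
have a1 : 0 <= 1 - a.
  rewrite subr_ge0 /a mulrC ler_pdivrMr ?ltr0n ?mul1r ?ler_nat ?leq_pred //.
  by case: K K2.
(* The gap [1 - a (1 - B^-1)] is a convex combination of the identity and [B^-1]. *)
rewrite (_ : _ - _ = (1 - a) *: 1%:M + a *: invmx B).
  by apply: psdD; apply: psdZ => //; [exact: psd1|exact: psd_invmx].
by rewrite scalerBr scalerBl scale1r opprB addrCA addrC.
Qed.

Lemma assimilation_mean_le :
  sqnorm (H *m ens_mean V) <= sqnorm (H *m ens_mean Vf) + sqnorm z.
Proof. by rewrite assimilation_mean; exact: mean_update_le. Qed.

End Assimilation.

(** * Conditional laws and conditional expectations *)

Section Freezing.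
Local Open Scope ereal_scope.
Context (R : realType) dX dY dT (X : measurableType dX) (Y : measurableType dY)
  (T : measurableType dT).
Variables (P : probability T R) (mu : probability X R) (ka : R.-pker X ~> Y).
Variables (f : T -> X) (eta : T -> Y).
Hypotheses (mf : measurable_fun setT f) (meta : measurable_fun setT eta).
Hypothesis disint : forall A B, measurable A -> measurable B ->
  \int[mu]_(x in A) ka x B = P (f @^-1` A `&` eta @^-1` B).

Let fst_graph (p : unit * X * Y) : X * Y := (p.1.2, p.2).

Let mfst_graph : measurable_fun setT fst_graph.
Proof.
apply/measurable_fun_pairP; split.
  rewrite (_ : _ \o _ = snd \o fst) //.
  exact: measurableT_comp measurable_snd measurable_fst.
by rewrite (_ : _ \o _ = snd) //; exact: measurable_snd.
Qed.

(** A composite of kernels needs a source: [unit] is a dummy one, which presents the law of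
    [(x, y)], with [x] drawn from [mu] and then [y] from [ka x], as a composite. *)
Let graph_kernel : R.-sfker (unit * X)%type ~> (X * Y)%type :=
  mkcomp (kernel.kernel_snd ka) (kdirac mfst_graph).

Let base : R.-sfker unit ~> X :=
  kprobability (measurable_cst (mu : pprobability X R)).

Let joint : {measure set (X * Y) -> \bar R} := (mkcomp base graph_kernel) tt.

Let integral_joint g : (forall p, 0 <= g p) -> measurable_fun setT g ->
  \int[joint]_p g p = \int[mu]_x \int[ka x]_y g (x, y).
Proof.
move=> g0 mg; rewrite /joint /mkcomp integral_kcomp //.
apply: eq_integral => x _; rewrite /graph_kernel integral_kcomp //.
by apply: eq_integral => y _; rewrite integral_dirac // diracT mul1e.
Qed.

(** By [disint], the law of [(f, eta)] agrees with the measure built from [mu] and [ka] on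
    measurable rectangles. These are stable under intersection and generate the product
    sigma-algebra, so the two measures coincide. *)
Lemma integral_freezing (g : X * Y -> \bar R) :
  (forall p, 0 <= g p) -> measurable_fun setT g ->
  \int[P]_w g (f w, eta w) = \int[mu]_x \int[ka x]_y g (x, y).
Proof.
move=> g0 mg; pose h w := (f w, eta w).
have mh : measurable_fun setT h by apply/measurable_fun_pairP; split.
rewrite -integral_joint //.
rewrite -[LHS]/(\int[P]_(w in h @^-1` setT) (g \o h) w).
rewrite -ge0_integral_pushforward //; apply: eq_measure_integral => A mA _.
pose G := [set A `*` B | A in measurable & B in measurable] : set (set (X * Y)).
apply: (measure_unique G (fun=> setT)) => //.
- exact: measurable_prod_measurableType.
- move=> _ _ [A1 mA1 [B1 mB1 <-]] [A2 mA2 [B2 mB2 <-]].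
  rewrite -setXI; exists (A1 `&` A2); first exact: measurableI.
  by exists (B1 `&` B2); first exact: measurableI.
- by move=> _; exists setT => //; exists setT => //; rewrite setXTT.
- by rewrite bigcup_const.
- move=> _ [A1 mA1 [B1 mB1 <-]].
  have mAB : measurable (A1 `*` B1) by exact: measurableX.
  rewrite (_ : joint _ = \int[joint]_p (\1_(A1 `*` B1) p)%:E); last first.
    by rewrite integral_indic // setIT.
  rewrite integral_joint; last 2 first.
  + by move=> p; rewrite lee_fin.
  + exact/measurable_EFinP/measurable_indic.
  rewrite [LHS](_ : _ = P (f @^-1` A1 `&` eta @^-1` B1)) //.
  rewrite -disint // [LHS]integral_mkcond; apply: eq_integral => x _.
  rewrite patchE; case: ifPn => xA.
    rewrite -[in LHS](setIT B1) -integral_indic //; apply: eq_integral => y _.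
    by rewrite !indicE in_setX /= xA.
  rewrite integral0_eq // => y _; rewrite indicE in_setX.
  by rewrite /= (negbTE xA).
- by move=> _; rewrite [ltLHS]probability_setT ltry.
Qed.

End Freezing.

(** * Disintegration along a measurable map, by Radon-Nikodym *)

Section Density.
Local Open Scope ereal_scope.
Context (R : realType) dX dT (X : measurableType dX) (T : measurableType dT).
Variables (P : probability T R) (f : {mfun T >-> X}).

Lemma measurable_mfun_preimage A : measurable A -> measurable (f @^-1` A).
Proof. by move=> mA; rewrite -[_ @^-1` _]setTI; exact: measurable_funP. Qed.

Section PushforwardDensity.
Variable Y : T -> \bar R.
Hypotheses (mY : measurable_fun setT Y) (Y0 : forall w, 0 <= Y w).

(** The push-forward along [f] of the measure with density [Y]. Carrying the proofs [mY] and [Y0] as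
    arguments lets a measure structure be attached to it. *)
Definition push_density (mY : measurable_fun setT Y) (Y0 : forall w, 0 <= Y w)
  (A : set X) : \bar R := \int[P]_(w in f @^-1` A) Y w.

Local Notation nu := (push_density mY Y0).

Let nu0 : nu set0 = 0.
Proof. by rewrite /push_density preimage_set0 integral_set0. Qed.

Let nu_ge0 A : 0 <= nu A.
Proof. exact: integral_ge0. Qed.

Let nu_sigma_additive : semi_sigma_additive nu.
Proof.
move=> F mF tF mUF; rewrite /push_density preimage_bigcup ge0_integral_bigcup //.
- by apply: is_cvg_nneseries => n _ _; exact: integral_ge0.
- by move=> k; exact: measurable_mfun_preimage.
- exact: measurable_funTS.
- apply/trivIsetP => i j _ _ ij; rewrite -preimage_setI.
  by move/trivIsetP : tF => /(_ i j I I ij) ->; rewrite preimage_set0.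
Qed.

HB.instance Definition _ := isMeasure.Build _ _ _ nu nu0 nu_ge0 nu_sigma_additive.

End PushforwardDensity.

(** The function [g] is the Radon-Nikodym derivative of [nu] with respect to the law of [f];
    finiteness of [nu] comes from the integrability of [Y]. *)
Lemma exists_disintegration (Y : T -> \bar R) :
  measurable_fun setT Y -> (forall w, 0 <= Y w) -> \int[P]_w Y w < +oo ->
  exists g : X -> \bar R, [/\ forall x, 0 <= g x, measurable_fun setT g &
    forall A, measurable A ->
      \int[P]_(w in f @^-1` A) g (f w) = \int[P]_(w in f @^-1` A) Y w].
Proof.
move=> mY Y0 Yoo; pose nu := push_density mY Y0.
have nufin : fin_num_fun nu.
  move=> A mA; rewrite ge0_fin_numE ?measure_ge0 //; apply: le_lt_trans Yoo.
  apply: ge0_subset_integral => //; exact: measurable_mfun_preimage.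
pose nu_isF := Measure_isFinite.Build _ _ _ nu nufin.
pose nuF : {finite_measure set X -> \bar R} := HB.pack nu nu_isF.
have nuac : nuF `<< distribution P f.
  apply/null_content_dominatesP => A mA A0.
  apply: null_set_integral => //; first exact: measurable_mfun_preimage.
  exact: measurable_funTS.
have [g [g0 /integrableP[mg _] gE]] := radon_nikodym_finite nuac.
exists g; split=> // A mA; rewrite -[RHS]/(nuF A) gE //.
by rewrite ge0_integral_pushforward //; exact: measurable_funTS.
Qed.

(** [Y] need not be integrable: the slices [k <= Y < k + 1] are treated
    separately and summed. *)
Lemma exists_disintegration_real (Y : T -> R) :
  measurable_fun setT Y -> (forall w, 0 <= Y w)%R ->
  exists g : X -> \bar R, [/\ forall x, 0 <= g x, measurable_fun setT g &
    forall A, measurable A ->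
      \int[P]_(w in f @^-1` A) g (f w) = \int[P]_(w in f @^-1` A) (Y w)%:E].
Proof.
move=> mY Y0.
pose D k := [set w | k%:R <= Y w < k.+1%:R]%R.
have mD k : measurable (D k).
  rewrite (_ : D k = Y @^-1` [set` `[k%:R, k.+1%:R[%R]); last first.
    by apply/seteqP; split=> w; rewrite /D /= in_itv.
  rewrite -[_ @^-1` _]setTI; exact: mY.
pose Yk k := (EFin \o Y) \_ (D k).
have mYk k : measurable_fun setT (Yk k).
  apply/measurable_restrict => //; rewrite setTI.
  by apply: measurable_funTS; exact/measurable_EFinP.
have Yk0 k w : 0 <= Yk k w by rewrite /Yk patchE; case: ifP => //; rewrite lee_fin.
have Ykoo k : \int[P]_w Yk k w < +oo.
  apply: (@le_lt_trans _ _ (\int[P]_w cst k.+1%:R%:E w)).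
    apply: ge0_le_integral => // w _; rewrite /Yk patchE /=; case: ifPn => [|_].
      by rewrite inE /D /= lee_fin => /andP[_ /ltW].
    by rewrite lee_fin.
  by rewrite integral_cst // [X in _ * X]probability_setT mule1 ltry.
(* At each [w] only the slice indexed by the integer part of [Y w] contributes. *)
have sumY w : \sum_(k <oo) Yk k w = (Y w)%:E.
  pose N := Num.truncn (Y w).
  have wN : D N w by rewrite /D /=; exact: truncn_itv.
  rewrite (@nneseriesD1 _ _ N) //.
  rewrite eseries0 ?adde0; first by rewrite /Yk patchE mem_set.
  move=> k _ kN; rewrite /Yk patchE; case: ifPn => //; rewrite inE => wk.
  move: kN; rewrite -(Num.Theory.truncn_def wk) -/N.
  by rewrite /= eqxx.
have /choice[g /all_and3[g0 mg gE]] := fun k =>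
  exists_disintegration (mYk k) (Yk0 k) (Ykoo k).
exists (fun x => \sum_(k <oo) g k x); split.
- by move=> x; apply: nneseries_ge0 => k _ _; exact: g0.
- by apply: ge0_emeasurable_sum => // k x _ _; exact: g0.
- move=> A mA; have mfA := measurable_mfun_preimage mA.
  under [RHS]eq_integral do rewrite -sumY.
  rewrite !integral_nneseries //.
  + by under eq_eseriesr do rewrite gE //.
  + by move=> k; exact: measurable_funTS.
  + by move=> k; apply: measurable_funTS; exact: measurableT_comp.
Qed.

End Density.

(** * Conditional expectation of non-negative variables *)

Section ConditionalExpectation.
Local Open Scope ereal_scope.
Context (R : realType) disp (T : measurableType disp) (P : probability T R).
Variable G : set (set T).
Hypotheses (GS : sigma_algebra setT G) (Gm : G `<=` measurable).

Local Notation TG := (g_sigma_algebraType G).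

Lemma g_sigma_measurableE : measurable = G :> set (set TG).
Proof. by rewrite -[RHS](sigma_algebra_id GS). Qed.

Lemma measurable_sub_sigma d' (U : measurableType d') (g : T -> U) :
  measurable_fun setT (g : TG -> U) -> measurable_fun setT g.
Proof.
move=> mg _ B mB; apply: Gm; rewrite -g_sigma_measurableE; exact: mg.
Qed.

Lemma measurable_to_sub_sigma : measurable_fun setT (id : T -> TG).
Proof.
by move=> _ B; rewrite g_sigma_measurableE => GB; rewrite setTI; exact: Gm.
Qed.

(** The identity onto the same space with the smaller sigma-algebra: conditioning on [G] is
    disintegration along this map. *)
Definition to_sub_sigma : {mfun T >-> TG} :=
  HB.pack (id : T -> TG) (isMeasurableFun.Build _ _ _ _ _ measurable_to_sub_sigma).

(** A version exists, so [condexp] does not take its default value here. *)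
Lemma is_condexp_condexp (Y : T -> R) :
  measurable_fun setT Y -> (forall w, 0 <= Y w)%R ->
  is_condexp P G (EFin \o Y) (condexp P G (EFin \o Y)).
Proof.
move=> mY Y0; apply: (@xgetPex _ (fun=> +oo) [set Z | is_condexp P G (EFin \o Y) Z]).
have [g [g0 mg gE]] := exists_disintegration_real P to_sub_sigma mY Y0.
exists g; split=> // A GA; apply: gE; by rewrite g_sigma_measurableE.
Qed.

(** An almost sure bound is recovered from integrals over events of [G]. The bad event is covered by
    countably many sets of [G] on which [W] is bounded, so that its integral is finite and can be
    cancelled. *)
Lemma condexp_le (Y W : T -> R) :
  measurable_fun setT Y -> (forall w, 0 <= Y w)%R ->
  measurable_fun setT (W : TG -> R) -> (forall w, 0 <= W w)%R ->
  (forall A, G A -> \int[P]_(w in A) (Y w)%:E <= \int[P]_(w in A) (W w)%:E) ->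
  {ae P, forall w, condexp P G (EFin \o Y) w <= (W w)%:E}.
Proof.
move=> mY Y0 mW W0 YW.
have [mZ Z0 ZY] := is_condexp_condexp mY Y0.
set Z := condexp _ _ _ in mZ Z0 ZY *.
(* On [B k] the bound fails by at least [1/(k+1)] while [W] is at most [k]; comparing integrals
   there forces [P (B k) = 0]. *)
pose B k := [set w | (W w)%:E + (k.+1%:R^-1)%:E <= Z w]
            `&` [set w | (W w)%:E <= k%:R%:E].
have mWE : measurable_fun setT (EFin \o W : TG -> \bar R).
  exact/measurable_EFinP.
have mWc k : measurable_fun setT ((fun w => (W w)%:E + (k.+1%:R^-1)%:E) : TG -> \bar R).
  exact: emeasurable_funD.
have GB k : G (B k).
  rewrite -g_sigma_measurableE; apply: measurableI.
    by rewrite -[X in measurable X]setTI; apply: measurable_lee.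
  by rewrite -[X in measurable X]setTI; apply: measurable_lee.
have PB k : P (B k) = 0.
  have mB := Gm (GB k).
  have mWB : measurable_fun (B k) (EFin \o W).
    exact/measurable_funTS/measurable_sub_sigma.
  have Wfin : \int[P]_(w in B k) (W w)%:E \is a fin_num.
    rewrite ge0_fin_numE; last by apply: integral_ge0 => w _; rewrite lee_fin.
    apply: (@le_lt_trans _ _ (\int[P]_(w in B k) cst k%:R%:E w)).
      by apply: ge0_le_integral => //; [move=> w _; rewrite lee_fin|move=> w []].
    rewrite integral_cst // lte_mul_pinfty // ?lee_fin //.
    by rewrite (le_lt_trans (probability_le1 P mB)) // ltry.
  have : \int[P]_(w in B k) ((W w)%:E + (k.+1%:R^-1)%:E)
      <= \int[P]_(w in B k) (W w)%:E.
    apply: le_trans (YW _ (GB k)); rewrite -(ZY _ (GB k)).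
    apply: ge0_le_integral => //.
    - by move=> w _; rewrite adde_ge0 // lee_fin.
    - exact/measurable_funTS/measurable_sub_sigma.
    - exact/measurable_funTS/measurable_sub_sigma.
    - by move=> w [].
  rewrite ge0_integralD //; last by move=> w _; rewrite lee_fin.
  rewrite -[X in _ + X]/(\int[P]_(w in B k) cst (k.+1%:R^-1)%:E w).
  rewrite integral_cst // -[leRHS]adde0 leeD2lE // => Ple.
  apply/eqP; rewrite eq_le measure_ge0 andbT.
  by move: Ple; rewrite pmule_rle0 // lte_fin.
have negB : P.-negligible (\bigcup_k B k).
  apply: negligible_bigcup => k; exists (B k).
  by split; [exact: Gm|exact: PB|].
suff : P.-negligible (~` [set w | Z w <= (W w)%:E]) by [].
apply: negligibleS negB => w /= /negP; rewrite -ltNge => WZ.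
(* A positive gap; it has to be finite even where [Z w] is [+oo], and is then taken to be 1. *)
have [z zW] : exists2 z : R, (0 < z)%R & (W w)%:E + z%:E <= Z w.
  case: (Z w) WZ => [r| |] // rW; last by exists 1%R => //; exact: leey.
  exists (r - W w)%R; first by rewrite subr_gt0 -lte_fin.
  by rewrite -EFinD lee_fin; lra.
(* Large enough for both conditions defining [B k]: [W w <= k] and [1/(k+1) <= z]. *)
pose k := maxn (Num.truncn (W w)).+1 (Num.truncn z^-1).+1.
move=> z0; exists k => //; split => /=.
  apply: le_trans z0; rewrite leeD2l // lee_fin.
  have z1 : (z^-1 < k.+1%:R)%R.
    apply: (lt_le_trans (real_truncnS_gt (num_real _))).
    by rewrite ler_nat ltnW // ltnS leq_maxr.
  rewrite -[leRHS]invrK lef_pV2 ?posrE ?invr_gt0 //; exact: ltW.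
rewrite lee_fin ltW //; apply: (lt_le_trans (real_truncnS_gt (num_real _))).
by rewrite ler_nat leq_maxl.
Qed.

(** Under conditioning on [G], a [G]-measurable argument may be held fixed while [eta] is integrated
    against its conditional law. *)
Lemma integral_cond_freezing dY (Y : measurableType dY) (ka : R.-pker TG ~> Y)
    (eta : T -> Y) : measurable_fun setT eta ->
  (forall A B, G A -> measurable B ->
    \int[P]_(w in A) ka w B = P (A `&` eta @^-1` B)) ->
  forall (g : TG * Y -> \bar R), (forall p, 0 <= g p) -> measurable_fun setT g ->
  forall A, G A -> \int[P]_(w in A) g (w, eta w)
    = \int[P]_(w in A) \int[ka w]_y g (w, y).
Proof.
move=> meta disint g g0 mg A GA.
have mA : measurable (A : set TG) by rewrite g_sigma_measurableE.
have disint' (B : set TG) C : measurable B -> measurable C ->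
    \int[distribution P to_sub_sigma]_(x in B) ka x C =
    P (to_sub_sigma @^-1` B `&` eta @^-1` C).
  move=> mB mC; rewrite ge0_integral_pushforward //; last first.
    exact/measurable_funTS/measurable_kernel.
  by apply: disint => //; move: mB; rewrite g_sigma_measurableE.
(* Cutting [g] off outside [A] reduces the integral over [A] to one over the whole space. *)
pose gA : TG * Y -> \bar R := g \_ ((A : set TG) `*` setT).
have gA0 p : 0 <= gA p by rewrite /gA patchE; case: ifP.
have mgA : measurable_fun setT gA.
  apply/measurable_restrict; [|exact: measurableT|].
    exact: (measurableX mA measurableT).
  exact: measurable_funTS.
have := integral_freezing (measurable_funP to_sub_sigma) meta disint' gA0 mgA.
rewrite [in RHS]ge0_integral_pushforward //; last 2 first.
- by apply: measurable_kfcomp.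
- by move=> x _; exact: integral_ge0.
rewrite [LHS](_ : _ = \int[P]_(w in A) g (w, eta w)); last first.
  rewrite [RHS]integral_mkcond; apply: eq_integral => w _.
  by rewrite /gA !patchE in_setX /= in_setT andbT.
move=> ->; rewrite [RHS]integral_mkcond; apply: eq_integral => w _.
rewrite patchE /=; case: ifPn => wA.
  by apply: eq_integral => y _; rewrite /gA patchE in_setX /= wA in_setT.
by rewrite integral0_eq // => y _; rewrite /gA patchE in_setX /= (negbTE wA).
Qed.

End ConditionalExpectation.

(** * Topology of the state space *)

Section Topology.
Variable R : realType.

Lemma continuous_mx (S : topologicalType) m n (f : S -> 'M[R]_(m, n)) :
  (forall i j, continuous (fun x => f x i j)) -> continuous f.
Proof.
move=> cf x A [B fB sBA].
have : \forall y \near x, forall i j, B i j (f y i j).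
  apply: filter_forall => i; apply: filter_forall => j.
  exact: cf (fB i j).
by apply: filterS => y By; exact: sBA.
Qed.

Lemma continuous_sqnorm_mulmx (S : topologicalType) q d (H : 'M[R]_(q, d))
    (g : S -> 'cV[R]_d) : (forall i, continuous (fun x => g x i 0)) ->
  continuous (fun x => sqnorm (H *m g x)).
Proof.
move=> cg.
have cH i : continuous (fun y => (H *m g y) i 0).
  rewrite (_ : (fun y => _) = (fun y => \sum_j H i j * g y j 0)); last first.
    by apply/funext => y; rewrite mxE.
  move=> x; apply: cvg_big => [|j _]; first exact: add_continuous.
  apply: cvgM; [exact: cvg_cst|exact: cg].
move=> x; apply: cvg_big => [|i _]; first exact: add_continuous.
apply: (@continuous_comp _ _ _ (fun y => (H *m g y) i 0) (fun r : R => r ^+ 2));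
  [exact: cH|exact: exprn_continuous].
Qed.

Lemma measurable_sqnorm_mulmx disp (S : measurableType disp) q d
    (H : 'M[R]_(q, d)) (g : S -> 'cV[R]_d) :
  (forall i, measurable_fun setT (fun x => g x i 0)) ->
  measurable_fun setT (fun x => sqnorm (H *m g x)).
Proof.
move=> mg; apply: measurable_sum => i; apply: measurable_funX.
under eq_fun do rewrite mxE.
by apply: measurable_sum => j; apply: measurable_funM.
Qed.

Lemma measurable_borel_continuous (S S' : ptopologicalType) (f : S -> S') :
  continuous f -> measurable_fun setT (f : borel S -> borel S').
Proof.
move=> /continuousP cf; apply: measurability; first by [].
by move=> _ [A oA <-]; rewrite setTI; apply: sub_sigma_algebra; exact: cf.
Qed.

(** Here [R] carries its own measurable structure rather than [borel], so preimages are tested on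
    open intervals. *)
Lemma measurable_real_continuous (S : ptopologicalType) (f : S -> R) :
  continuous f -> measurable_fun setT (f : borel S -> R).
Proof.
move=> /continuousP cf; apply: (measurability _ (RGenOpens.measurableE R)).
move=> _ [_ [a [b ->]] <-]; rewrite setTI.
by apply: sub_sigma_algebra; apply: cf; exact: interval_open.
Qed.

(** The box is the continuous image under [vec_mx] of a product of segments. *)
Lemma compact_mx_box m n (r : R) :
  compact [set M : 'M[R]_(m, n) | forall i j, `|M i j| <= r].
Proof.
have -> : [set M : 'M[R]_(m, n) | forall i j, `|M i j| <= r] =
    vec_mx @` [set v : 'rV[R]_(m * n) | forall i, `[- r, r]%classic (v ord0 i)].
  apply/seteqP; split=> M /=.
    move=> Mr; exists (mxvec M); rewrite ?mxvecK // => k.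
    by case/mxvec_indexP: k => i j; rewrite mxvecE /= in_itv /= -ler_norml.
  move=> [v vr <-] i j; rewrite mxE.
  by have := vr (mxvec_index i j); rewrite /= in_itv /= -ler_norml.
apply: continuous_compact; last first.
  apply: (@rV_compact _ _ (fun=> `[- r, r]%classic)) => i.
  exact: segment_compact.
apply: continuous_subspaceT; apply: continuous_mx => i j.
rewrite (_ : (fun v => _) =
    (fun v : 'rV[R]_(m * n) => v 0 (mxvec_index i j))); last first.
  by apply/funext => v; rewrite mxE.
exact: coord_continuous.
Qed.

End Topology.

(** * Regularity and sub-level sets of the energies *)

Section Energies.
Variables (R : realType) (d q K : nat) (H : 'M[R]_(q, d)).
Local Notation state := (state R d K).

Lemma continuous_state_fst i : continuous (fun x : state => x.1 i 0).
Proof.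
move=> x; apply: (@continuous_comp _ _ _ fst (fun u : 'cV[R]_d => u i 0)).
  exact: cvg_fst.
exact: coord_continuous.
Qed.

Lemma continuous_state_snd i k : continuous (fun x : state => x.2 i k).
Proof.
move=> x; apply: (@continuous_comp _ _ _ snd (fun V : 'M[R]_(d, K) => V i k)).
  exact: cvg_snd.
exact: coord_continuous.
Qed.

Lemma continuous_state_col k : continuous (fun x : state => col k x.2).
Proof.
apply: continuous_mx => i j.
rewrite (_ : (fun x => _) = (fun x : state => x.2 i k));
  first exact: continuous_state_snd.
by apply/funext => x; rewrite mxE.
Qed.

Lemma continuous_ensemble_energy (M : R) :
  continuous (ensemble_energy H M : state -> R).
Proof.
move=> x; apply: cvgD.
  apply: cvg_big => [|k _]; first exact: add_continuous.
  apply: (@continuous_sqnorm_mulmx _ _ _ _ H (fun x : state => col k x.2)) => i.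
  rewrite (_ : (fun x => _) = (fun x : state => x.2 i k));
  first exact: continuous_state_snd.
  by apply/funext => y; rewrite mxE.
apply: cvgM; first exact: cvg_cst.
apply: (@continuous_sqnorm_mulmx _ _ _ _ H (fun x : state => x.1)) => i.
exact: continuous_state_fst.
Qed.

Lemma measurable_mean_energy (M : R) :
  measurable_fun setT (mean_energy H M : borel state -> R).
Proof.
have mu i : measurable_fun setT ((fun x => x.1 i 0) : borel state -> R).
  by apply: measurable_real_continuous; exact: continuous_state_fst.
have mv i k : measurable_fun setT ((fun x => x.2 i k) : borel state -> R).
  by apply: measurable_real_continuous; exact: continuous_state_snd.
apply: measurable_funD; last first.
  apply: measurable_funM; first exact: measurable_cst.
  by apply: measurable_sqnorm_mulmx => i; exact: mu.
apply: measurable_sqnorm_mulmx => i; under eq_fun do rewrite mxE summxE.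
apply: measurable_funM; first exact: measurable_cst.
apply: measurable_sum => k; under eq_fun do rewrite mxE.
exact: mv.
Qed.

Lemma mean_energy_ge0 (M : R) (x : state) : 0 <= M -> 0 <= mean_energy H M x.
Proof. by move=> M0; rewrite addr_ge0 ?mulr_ge0 // sqnorm_ge0. Qed.

Lemma ensemble_energy_ge0 (M : R) (x : state) :
  0 <= M -> 0 <= ensemble_energy H M x.
Proof.
move=> M0; rewrite addr_ge0 ?mulr_ge0 ?sqnorm_ge0 //.
by apply: sumr_ge0 => k _; exact: sqnorm_ge0.
Qed.

Hypothesis rankH : \rank H = d.

(** Rank [d] gives a left inverse [L] of [H], and [v = L (H v)]. *)
Lemma exists_sqnorm_le_obs :
  exists2 a : R, 0 < a & forall v : 'cV[R]_d, sqnorm v <= a * sqnorm (H *m v).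
Proof.
have /row_fullP[L LH] : row_full H by rewrite /row_full rankH.
have [a a0 La] := sqnorm_mulmx_le L; exists a => // v.
by rewrite -[v in sqnorm v]mul1mx -LH -mulmxA.
Qed.

(** The sub-level set is closed by continuity and lies in a compact box; [1 <= K M] lets the energy
    dominate [|H U|^2]. *)
Lemma compact_ensemble_energy (M b : R) : 1 <= K%:R * M ->
  compact [set x : state | ensemble_energy H M x <= b].
Proof.
move=> KM; have [a a0 aH] := exists_sqnorm_le_obs.
(* Avoids a square root: [t^2 <= a b] and [t >= 0] give [t <= 2 t <= t^2 + 1 <= r]. *)
pose r := a * b + 1.
have box n (v : 'cV[R]_n) i : sqnorm v <= a * b -> `|v i 0| <= r.
  move=> vb; have := le_trans (sqnorm_coord_le v i) vb.
  rewrite -real_normK ?num_real // => vi.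
  have := sqr_ge0 (`|v i 0| - 1); rewrite /r; have := normr_ge0 (v i 0); nra.
apply: (@subclosed_compact _ _
    ([set u : 'cV[R]_d | forall i j, `|u i j| <= r] `*`
     [set V : 'M[R]_(d, K) | forall i j, `|V i j| <= r])).
- have /continuous_closedP/(_ _ (@closed_le R b)) := @continuous_ensemble_energy M.
  by [].
- by apply: compact_setX; exact: compact_mx_box.
- move=> x /= xb; split=> i j /=.
    rewrite ord1; apply: box; apply: (le_trans (aH _)); rewrite ler_pM2l //.
    apply: le_trans xb; rewrite /ensemble_energy ler_wpDl //.
      by apply: sumr_ge0 => k _; exact: sqnorm_ge0.
    by rewrite ler_peMl // sqnorm_ge0.
  have -> : x.2 i j = (col j x.2) i 0 by rewrite mxE.
  apply: box; apply: (le_trans (aH _)); rewrite ler_pM2l //.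
  apply: le_trans xb; rewrite /ensemble_energy ler_wpDr //.
    by rewrite mulr_ge0 ?sqnorm_ge0 // (le_trans ler01).
  rewrite (bigD1 j) //= lerDl; apply: sumr_ge0 => k _; exact: sqnorm_ge0.
Qed.

End Energies.

(** * Second moments *)

Section Moments.
Local Open Scope ereal_scope.
Context (R : realType) dY (Y : measurableType dY) (mu : {measure set Y -> \bar R}).
Hypothesis mu1 : mu setT = 1.

(** Integrability and value are kept together, so that linear combinations are integrated by
    structural rules. *)
Definition has_integral (f : Y -> R) (r : R) : Prop :=
  mu.-integrable setT (EFin \o f) /\ \int[mu]_x (f x)%:E = r%:E.

Lemma has_integral_cst (r : R) : has_integral (fun=> r) r.
Proof.
split.
  apply/integrableP; split; first exact: measurable_cst.
  by rewrite integral_cst // mu1 mule1 ltry.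
by rewrite -[LHS]/(\int[mu]_x cst r%:E x) integral_cst // mu1 mule1.
Qed.

Lemma has_integralD f g r s :
  has_integral f r -> has_integral g s -> has_integral (f \+ g)%R (r + s)%R.
Proof.
move=> [fi fr] [gi gs]; split; first exact: (integrableD measurableT fi gi).
rewrite -[LHS]/(\int[mu]_x ((f x)%:E + (g x)%:E)).
by rewrite integralD_EFin // fr gs.
Qed.

Lemma has_integralZ (c : R) f r :
  has_integral f r -> has_integral (fun x => c * f x)%R (c * r)%R.
Proof.
move=> [fi fr]; split; first exact: (integrableZl measurableT c fi).
rewrite -[LHS]/(\int[mu]_x (c%:E * (f x)%:E)).
by rewrite integralZl // fr.
Qed.

Lemma has_integral_sum I (s : seq I) f r :
  (forall i, has_integral (f i) (r i)) ->
  has_integral (fun x => \sum_(i <- s) f i x)%R (\sum_(i <- s) r i)%R.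
Proof.
move=> fr; elim: s => [|i s ih].
  rewrite big_nil [f in has_integral f](_ : _ = fun=> 0%R); last first.
    by apply/funext => x; rewrite big_nil.
  exact: has_integral_cst.
rewrite big_cons [f in has_integral f](_ : _ = f i \+ (fun x => \sum_(i <- s) f i x))%R.
  exact: has_integralD.
by apply/funext => x; rewrite big_cons.
Qed.

End Moments.

Section SecondMoment.
Context (R : realType) (d q : nat) (H : 'M[R]_(q, d)).
Variables (mu : {measure set (borel 'cV[R]_d) -> \bar R}) (C : 'M[R]_d).
Hypotheses (mu1 : mu setT = 1%E) (muC : centered_cov mu C).

(** In the expansion of [|H a + H y|^2] the cross term has mean zero and the quadratic term has mean
    [tr (H C H^T)]. This is the left side of the energy criterion when [a] is [Psi u]. *)
Lemma integral_sqnorm_shift (a : 'cV[R]_d) :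
  (\int[mu]_y (sqnorm (H *m (a + y)))%:E =
   (sqnorm (H *m a) + \tr (H *m C *m H^T))%:E)%E.
Proof.
have h1 j : has_integral mu (fun y : borel 'cV[R]_d => y j 0) 0.
  by have [] := muC.1 j.
have h2 j k : has_integral mu (fun y : borel 'cV[R]_d => y j 0 * y k 0) (C j k).
  by have [] := muC.2 j k.
(* The squared norm as a polynomial in the coordinates of [y]; the factor 0 is the mean of each
   coordinate, kept so that the rules apply termwise. *)
have h : has_integral mu (fun y : borel 'cV[R]_d => sqnorm (H *m a)
    + \sum_i \sum_j (2 * (H *m a) i 0 * H i j) * y j 0
    + \sum_i \sum_j \sum_k (H i j * H i k) * (y j 0 * y k 0))
    (sqnorm (H *m a) + \sum_(i < q) \sum_(j < d) (2 * (H *m a) i 0 * H i j) * 0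
    + \sum_i \sum_j \sum_k (H i j * H i k) * C j k).
  apply: has_integralD.
    apply: has_integralD; first exact: has_integral_cst.
    apply: has_integral_sum => // i; apply: has_integral_sum => // j.
    exact: has_integralZ.
  apply: has_integral_sum => // i; apply: has_integral_sum => // j.
  by apply: has_integral_sum => // k; exact: has_integralZ.
case: h => _ hE; transitivity (\int[mu]_y ((sqnorm (H *m a)
    + \sum_i \sum_j (2 * (H *m a) i 0 * H i j) * y j 0
    + \sum_i \sum_j \sum_k (H i j * H i k) * (y j 0 * y k 0))%:E))%E.
  apply: eq_integral => y _; congr EFin; rewrite mulmxDr sqnormD; congr (_ + _ + _).
    rewrite /dotv mulr_sumr; apply: eq_bigr => i _.
    rewrite [X in _ * (_ * X)]mxE mulr_sumr mulr_sumr; apply: eq_bigr => j _.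
    by rewrite !mulrA.
  apply: eq_bigr => i _; rewrite mxE expr2 mulr_suml; apply: eq_bigr => j _.
  by rewrite mulr_sumr; apply: eq_bigr => k _; ring.
rewrite hE; congr EFin; rewrite [X in _ + X + _]big1 ?addr0; last first.
  by move=> i _; rewrite big1 // => j _; rewrite mulr0.
congr (_ + _); apply: eq_bigr => i _; rewrite mxE exchange_big /=.
apply: eq_bigr => k _; rewrite !mxE mulr_suml; apply: eq_bigr => j _; ring.
Qed.

End SecondMoment.

Section KernelPrecomp.
Local Open Scope ereal_scope.
Context (R : realType) dX dY dZ (X : measurableType dX) (Y : measurableType dY)
  (Z : measurableType dZ).
Variables (k : R.-pker Y ~> Z) (f : X -> Y).

Definition kernel_precomp (mf : measurable_fun setT f) (x : X) :
  {measure set Z -> \bar R} := k (f x).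

Hypothesis mf : measurable_fun setT f.

Let measurable_kernel_precomp U : measurable U ->
  measurable_fun setT (kernel_precomp mf ^~ U).
Proof. by move=> mU; exact: measurableT_comp (measurable_kernel k _ mU) mf. Qed.

HB.instance Definition _ := isKernel.Build _ _ _ _ _ (kernel_precomp mf)
  measurable_kernel_precomp.

Let kernel_precomp_prob x : kernel_precomp mf x setT = 1.
Proof. exact: prob_kernel. Qed.

HB.instance Definition _ := Kernel_isProbability.Build _ _ _ _ _
  (kernel_precomp mf) kernel_precomp_prob.

End KernelPrecomp.

(** * One step of the filter *)

Section ConditionalDomination.
Context (R : realType) disp (T : measurableType disp) (P : probability T R).
Variable G : set (set T).
Hypothesis Gm : G `<=` measurable.

Implicit Types Y W Z : T -> R.

(** Stands for [E(Y | G) <= E(W | G)] and is meaningful for non-integrable [Y]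
    and [W]. *)
Definition cond_dom (Y W : T -> R) : Prop :=
  [/\ measurable_fun setT Y, measurable_fun setT W,
      forall w, 0 <= Y w, forall w, 0 <= W w &
      forall A, G A ->
        (\int[P]_(w in A) (Y w)%:E <= \int[P]_(w in A) (W w)%:E)%E].

Lemma cond_dom_ae Y W : measurable_fun setT Y -> measurable_fun setT W ->
  (forall w, 0 <= Y w) -> (forall w, 0 <= W w) ->
  {ae P, forall w, Y w <= W w} -> cond_dom Y W.
Proof.
move=> mY mW Y0 W0 YW; split=> // A /Gm mA.
apply: ae_ge0_le_integral => //.
- by move=> w _; rewrite lee_fin.
- exact/measurable_funTS/measurable_EFinP.
- by move=> w _; rewrite lee_fin.
- exact/measurable_funTS/measurable_EFinP.
- by apply: filterS YW => w YWw _; rewrite lee_fin.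
Qed.

Lemma cond_dom_trans Y W Z : cond_dom Y W -> cond_dom W Z -> cond_dom Y Z.
Proof.
move=> [mY _ Y0 _ YW] [_ mZ _ Z0 WZ]; split=> // A GA.
exact: le_trans (YW _ GA) (WZ _ GA).
Qed.

Lemma cond_domD Y W Y' W' : cond_dom Y W -> cond_dom Y' W' ->
  cond_dom (fun w => Y w + Y' w) (fun w => W w + W' w).
Proof.
move=> [mY mW Y0 W0 YW] [mY' mW' Y'0 W'0 YW'].
split; [exact: measurable_funD|exact: measurable_funD| | |].
- by move=> w; rewrite addr_ge0.
- by move=> w; rewrite addr_ge0.
move=> A GA; have mA := Gm GA.
under eq_integral do rewrite EFinD.
under [leRHS]eq_integral do rewrite EFinD.
rewrite !ge0_integralD //; try by move=> w _; rewrite lee_fin.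
- by rewrite leeD // ?YW ?YW'.
- exact/measurable_funTS/measurable_EFinP.
- exact/measurable_funTS/measurable_EFinP.
- exact/measurable_funTS/measurable_EFinP.
- exact/measurable_funTS/measurable_EFinP.
Qed.

Lemma cond_domZ (a : R) Y W : 0 <= a -> cond_dom Y W ->
  cond_dom (fun w => a * Y w) (fun w => a * W w).
Proof.
move=> a0 [mY mW Y0 W0 YW].
split; [exact: measurable_funM|exact: measurable_funM| | |].
- by move=> w; rewrite mulr_ge0.
- by move=> w; rewrite mulr_ge0.
move=> A GA; have mA := Gm GA.
under eq_integral do rewrite EFinM.
under [leRHS]eq_integral do rewrite EFinM.
rewrite !ge0_integralZl //; try by move=> w _; rewrite lee_fin.
- by rewrite lee_wpmul2l ?lee_fin // YW.
- exact/measurable_funTS/measurable_EFinP.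
- exact/measurable_funTS/measurable_EFinP.
Qed.

Lemma cond_dom_refl Y : measurable_fun setT Y -> (forall w, 0 <= Y w) ->
  cond_dom Y Y.
Proof. by move=> mY Y0; split. Qed.

Lemma cond_dom_sum I (s : seq I) (Y W : I -> T -> R) : (forall i, cond_dom (Y i) (W i)) ->
  cond_dom (fun w => \sum_(i <- s) Y i w) (fun w => \sum_(i <- s) W i w).
Proof.
move=> YW; elim: s => [|i s ih].
  under eq_fun do rewrite big_nil; under [X in cond_dom _ X]eq_fun do rewrite big_nil.
  exact: cond_dom_refl.
under eq_fun do rewrite big_cons; under [X in cond_dom _ X]eq_fun do rewrite big_cons.
exact: cond_domD.
Qed.

End ConditionalDomination.

(** Stated for extended reals because the initial energy may be infinite. *)
Lemma gronwall_ereal (R : realType) (e : nat -> \bar R) (b c : R) :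
  0 < b < 1 -> 0 < c -> (forall n, 0 <= e n)%E ->
  (forall n, e n.+1 <= (1 - b)%:E * e n + c%:E)%E ->
  forall n, (e n <= ((1 - b) ^+ n)%:E * e 0%N + (c / b)%:E)%E.
Proof.
case/andP => b0 b1 c0 e0 eS; elim=> [|n ih].
  by rewrite expr0 mul1e leeDl // lee_fin divr_ge0 // ltW.
have b1' : 0 <= 1 - b by lra.
apply: (le_trans (eS n)).
(* The constant [c / b] is the fixed point of [x -> (1 - b) x + c]. *)
rewrite (_ : (c / b)%:E = ((1 - b)%:E * (c / b)%:E + c%:E)%E); last first.
  by rewrite -EFinM -EFinD; congr EFin; field; rewrite gt_eqF.
rewrite exprS EFinM -muleA addeA leeD2r //.
rewrite -ge0_muleDr; last 2 first.
- by rewrite mule_ge0 // lee_fin exprn_ge0.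
- by rewrite lee_fin divr_ge0 // ltW.
by rewrite lee_wpmul2l // lee_fin.
Qed.

Section Model.
Context (R : realType) (disp : measure_display) (T : measurableType disp)
  (P : probability T R).
Variables (d q K : nat) (H : 'M[R]_(q, d)).
Variables (Psi : 'cV[R]_d -> 'cV[R]_d) (Rh : 'cV[R]_d -> 'M[R]_d).
Variable law : nat -> R.-pker (borel 'cV[R]_d) ~> (borel 'cV[R]_d).
Variable law_xi : probability (borel 'cV[R]_q) R.
Variables (U : nat -> T -> 'cV[R]_d) (V : nat -> T -> 'M[R]_(d, K)).
Variables (zeta : nat -> T -> 'cV[R]_d) (zetaV : nat -> 'I_K -> T -> 'cV[R]_d).
Variable xi : nat -> T -> 'cV[R]_q.
Hypothesis hmodel : signal_noise_model P Psi Rh law law_xi U V zeta zetaV xi.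
Variables (beta K_h : R).
Hypotheses (hbeta : 0 < beta < 1) (hKh : 0 < K_h).
Hypothesis henergy : observable_energy_criterion H Psi Rh beta K_h.

Local Notation X := (chain U V).

Lemma sigma_algebra_past n : sigma_algebra setT (past X n).
Proof. exact: smallest_sigma_algebra. Qed.

Lemma past_measurable n : past X n `<=` measurable.
Proof.
apply: smallest_sub; first exact: sigma_algebra_measurable.
move=> _ [m _ [B mB <-]]; rewrite setTI.
by rewrite -[_ @^-1` _]setTI; exact: (measurable_chain hmodel m).
Qed.

Lemma measurable_chain_past n : measurable_fun setT
  (X n : g_sigma_algebraType (past X n) -> borel (state R d K)).
Proof.
move=> _ B mB; rewrite setTI; apply: sub_sigma_algebra; apply: sub_sigma_algebra.
by exists n => //=; exists B; rewrite ?setTI.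
Qed.

Lemma measurable_U_past n : measurable_fun setT
  (U n : g_sigma_algebraType (past X n) -> borel 'cV[R]_d).
Proof.
have mfst : measurable_fun setT (fst : borel (state R d K) -> borel 'cV[R]_d).
  by apply: measurable_borel_continuous => x; exact: cvg_fst.
exact: measurableT_comp mfst (@measurable_chain_past n).
Qed.

Lemma measurable_V_past n k : measurable_fun setT
  ((fun w => col k (V n w)) : g_sigma_algebraType (past X n) -> borel 'cV[R]_d).
Proof.
have mcol : measurable_fun setT
    ((fun x => col k x.2) : borel (state R d K) -> borel 'cV[R]_d).
  by apply: measurable_borel_continuous; exact: continuous_state_col.
exact: measurableT_comp mcol (@measurable_chain_past n).
Qed.

(** A marginal of the joint conditional law: the other noises are tested on the whole space, which
    has probability 1. *)
Lemma signal_noise_law n A (B : set (borel 'cV[R]_d)) :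
  past X n A -> measurable B ->
  (\int[P]_(w in A) law n.+1 (U n w) B = P (A `&` zeta n.+1 @^-1` B))%E.
Proof.
move=> pA mB; have mA := past_measurable pA.
have [_ _ /(_ A pA)] := noise_conditional_law hmodel n mB
  (fun=> measurableT) measurableT.
rewrite [X in _ = X -> _](_ : _ = P (A `&` zeta n.+1 @^-1` B)) => [<-|].
  apply: eq_integral => w _; rewrite probability_setT mule1 big1 ?mule1 //.
  by move=> k _; rewrite prob_kernel.
rewrite [X in \1_X](_ : _ = zeta n.+1 @^-1` B); last first.
  by apply/seteqP; split=> w; [case|].
rewrite integral_indic //; first by rewrite setIC.
rewrite -[_ @^-1` _]setTI; exact: (measurable_zeta hmodel n).
Qed.

Lemma ensemble_noise_law n k A (B : set (borel 'cV[R]_d)) :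
  past X n A -> measurable B ->
  (\int[P]_(w in A) law n.+1 (col k (V n w)) B
   = P (A `&` zetaV n.+1 k @^-1` B))%E.
Proof.
move=> pA mB; have mA := past_measurable pA.
have mBk j : measurable (if j == k then B else setT) by case: ifP.
have [_ _ /(_ A pA)] := noise_conditional_law hmodel n measurableT mBk measurableT.
rewrite [X in _ = X -> _](_ : _ = P (A `&` zetaV n.+1 k @^-1` B)) => [<-|].
  apply: eq_integral => w _; rewrite prob_kernel mul1e probability_setT mule1.
  rewrite (bigD1 k) //= eqxx big1 ?mule1 // => j /negbTE ->.
  by rewrite prob_kernel.
rewrite [X in \1_X](_ : _ = zetaV n.+1 k @^-1` B); last first.
  apply/seteqP; split=> w; first by case=> _ /(_ k); rewrite eqxx.
  by move=> Bw; split=> // j; case: eqP => // ->.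
rewrite integral_indic //; first by rewrite setIC.
rewrite -[_ @^-1` _]setTI; exact: (measurable_zetaV hmodel n k).
Qed.

Lemma observation_noise_law n A (B : set (borel 'cV[R]_q)) :
  past X n A -> measurable B ->
  (\int[P]_(w in A) law_xi B = P (A `&` xi n.+1 @^-1` B))%E.
Proof.
move=> pA mB; have mA := past_measurable pA.
have [_ _ /(_ A pA)] := noise_conditional_law hmodel n measurableT
  (fun=> measurableT) mB.
rewrite [X in _ = X -> _](_ : _ = P (A `&` xi n.+1 @^-1` B)) => [<-|].
  apply: eq_integral => w _; rewrite prob_kernel mul1e big1 ?mul1e //.
  by move=> k _; rewrite prob_kernel.
rewrite [X in \1_X](_ : _ = xi n.+1 @^-1` B); last first.
  by apply/seteqP; split=> w; [case|].
rewrite integral_indic //; first by rewrite setIC.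
rewrite -[_ @^-1` _]setTI; exact: (measurable_xi hmodel n).
Qed.

Lemma measurable_coord m n i j :
  measurable_fun setT ((fun M => M i j) : borel 'M[R]_(m, n) -> R).
Proof. by apply: measurable_real_continuous; exact: coord_continuous. Qed.

(** One statement for the signal and for every ensemble member: [f] is [U n] or a column of [V n],
    and [eta] its noise. Freezing [f] leaves the second moment of the noise, to which the energy
    criterion applies. *)
Lemma forecast_dom n (f eta : T -> 'cV[R]_d) :
  measurable_fun setT (f : g_sigma_algebraType (past X n) -> borel 'cV[R]_d) ->
  measurable_fun setT (eta : T -> borel 'cV[R]_d) ->
  (forall A (B : set (borel 'cV[R]_d)), past X n A -> measurable B ->
    (\int[P]_(w in A) law n.+1 (f w) B = P (A `&` eta @^-1` B))%E) ->
  cond_dom P (past X n) (fun w => sqnorm (H *m (Psi (f w) + eta w)))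
    (fun w => (1 - beta) * sqnorm (H *m f w) + K_h).
Proof.
move=> mf meta disint.
have [GS Gm] := (sigma_algebra_past n, @past_measurable n).
have mfT : measurable_fun setT (f : T -> borel 'cV[R]_d).
  exact: (measurable_sub_sigma GS Gm mf).
have mPsif dX (S : measurableType dX) (h : S -> borel 'cV[R]_d) i :
    measurable_fun setT h -> measurable_fun setT (fun w => Psi (h w) i 0).
  move=> mh; apply: (measurableT_comp (@measurable_coord d 1 i 0)).
  exact: measurableT_comp (measurable_Psi hmodel) mh.
have mY : measurable_fun setT (fun w => sqnorm (H *m (Psi (f w) + eta w))).
  apply: measurable_sqnorm_mulmx => i; under eq_fun do rewrite mxE.
  apply: measurable_funD; first exact: mPsif.
  exact: (measurableT_comp (@measurable_coord d 1 i 0) meta).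
have mW : measurable_fun setT (fun w => (1 - beta) * sqnorm (H *m f w) + K_h).
  apply: measurable_funD => //; apply: measurable_funM => //.
  apply: measurable_sqnorm_mulmx => i.
  exact: (measurableT_comp (@measurable_coord d 1 i 0) mfT).
have W0 w : 0 <= (1 - beta) * sqnorm (H *m f w) + K_h.
  rewrite addr_ge0 ?(ltW hKh) // mulr_ge0 ?sqnorm_ge0 // subr_ge0 ltW //.
  by case/andP: hbeta.
split=> // [w|A pA]; first exact: sqnorm_ge0.
have mA := Gm _ pA.
pose g (p : g_sigma_algebraType (past X n) * borel 'cV[R]_d) : \bar R :=
  (sqnorm (H *m (Psi (f p.1) + p.2)))%:E.
have g0 p : (0 <= g p)%E by rewrite lee_fin sqnorm_ge0.
have mg : measurable_fun setT g.
  apply/measurable_EFinP; apply: measurable_sqnorm_mulmx => i.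
  under eq_fun do rewrite mxE.
  apply: measurable_funD.
    by apply: mPsif; exact: measurableT_comp mf measurable_fst.
  exact: (measurableT_comp (@measurable_coord d 1 i 0) measurable_snd).
pose ka := kernel_precomp (law n.+1) mf.
rewrite -[leLHS]/(\int[P]_(w in A) g (w, eta w))%E.
rewrite (@integral_cond_freezing _ _ _ _ _ GS Gm _ _ ka _ meta disint g g0 mg) //.
apply: ge0_le_integral => //.
- by move=> w _; exact: integral_ge0.
- apply: measurable_funTS; apply: (measurable_sub_sigma GS Gm).
  exact: (measurable_kfcomp ka).
- exact/measurable_funTS/measurable_EFinP.
move=> w _; rewrite /g /= /ka /kernel_precomp.
rewrite (integral_sqnorm_shift H (prob_kernel _) (law_moments hmodel n (f w))).
rewrite lee_fin; exact: henergy.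
Qed.

Lemma observation_noise_dom n :
  cond_dom P (past X n) (fun w => sqnorm (xi n.+1 w)) (fun=> q%:R).
Proof.
have [GS Gm] := (sigma_algebra_past n, @past_measurable n).
have mxi := measurable_xi hmodel n.
(* In this form [integral_sqnorm_shift] applies with identity matrix and zero shift, giving the mean
   [tr 1 = q]. *)
have nsq (S : Type) (h : S -> 'cV[R]_q) :
    (fun w => sqnorm (h w)) = (fun w => sqnorm (1%:M *m (0 + h w))).
  by apply/funext => w; rewrite mul1mx add0r.
have mY : measurable_fun setT (fun w => sqnorm (xi n.+1 w)).
  rewrite nsq; apply: measurable_sqnorm_mulmx => i; under eq_fun do rewrite add0r.
  exact: (measurableT_comp (@measurable_coord q 1 i 0) mxi).
split=> // [w|A pA]; first exact: sqnorm_ge0.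
have mA := Gm _ pA.
pose TG := g_sigma_algebraType (past X n).
pose g (p : TG * borel 'cV[R]_q) : \bar R := (sqnorm (1%:M *m (0 + p.2)))%:E.
have mg : measurable_fun setT g.
  apply/measurable_EFinP; apply: measurable_sqnorm_mulmx => i.
  under eq_fun do rewrite add0r.
  exact: (measurableT_comp (@measurable_coord q 1 i 0) measurable_snd).
pose ka : R.-pker TG ~> borel 'cV[R]_q :=
  kprobability (measurable_cst (law_xi : pprobability _ R)).
rewrite [leLHS](_ : _ = \int[P]_(w in A) g (w, xi n.+1 w))%E; last first.
  by apply: eq_integral => w _; rewrite /g mul1mx add0r.
rewrite (@integral_cond_freezing _ _ _ _ _ GS Gm _ _ ka _ mxi) //.
- under eq_integral => w _.
    rewrite (integral_sqnorm_shift _ (probability_setT _) (law_xi_moments hmodel)).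
    rewrite mulmx0 mulmx1 mul1mx trmx1 mxtrace1.
    over.
  by rewrite -(dotvv 0) dotv0 add0r.
- by move=> B C pB mC; exact: observation_noise_law.
- by move=> p; rewrite lee_fin sqnorm_ge0.
Qed.

(** * Energy estimates across forecast and assimilation *)

Variables (kind : esrf_kind) (C : nat -> T -> 'M[R]_d).
Hypothesis hK : (2 <= K)%N.
Hypothesis hC : forall n, (1 <= n)%N -> {ae P, forall w, psd (C n w)}.
Hypothesis hesrf : esrf P H kind Psi C U V zetaV xi.
(** Makes [(2 + M) (1 - beta) <= (1 - beta / 2) M], so that the weight [M] absorbs
    the signal energy that the observations feed into the ensemble. *)
Variable M : R.
Hypothesis hM : 4 <= beta * M.

Let K0 : 0 < K%:R :> R.
Proof. by rewrite ltr0n; case: K hK. Qed.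

Let M4 : 4 <= M.
Proof. by case/andP: hbeta hM => b0 b1; nra. Qed.

Let forecast_col n w k :
  col k (forecast Psi V zetaV n.+1 w) = Psi (col k (V n w)) + zetaV n.+1 k w.
Proof. by apply/colP => i; rewrite !mxE. Qed.

(** A bound for the next mean energy in terms of the noises. In the weight [2 + M], the 2 comes from
    [|z|^2 <= 2 |H U|^2 + 2 |xi|^2] and [M] from the energy itself. *)
Definition noisy_energy n w : R :=
  K%:R^-1 * \sum_(k < K) sqnorm (H *m (Psi (col k (V n w)) + zetaV n.+1 k w))
  + (2 + M) * sqnorm (H *m (Psi (U n w) + zeta n.+1 w))
  + 2 * sqnorm (xi n.+1 w).

(** What [noisy_energy] becomes when each term is replaced by its bound in conditional mean. *)
Definition predicted_energy n w : R :=
  K%:R^-1 * \sum_(k < K) ((1 - beta) * sqnorm (H *m col k (V n w)) + K_h)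
  + (2 + M) * ((1 - beta) * sqnorm (H *m U n w) + K_h) + 2 * q%:R.

Lemma noisy_energy_dom n :
  cond_dom P (past X n) (noisy_energy n) (predicted_energy n).
Proof.
have Gm := @past_measurable n.
apply: (cond_domD Gm); first apply: (cond_domD Gm).
- apply: (cond_domZ Gm); first by rewrite invr_ge0.
  apply: (cond_dom_sum Gm) => k.
  apply: (forecast_dom (@measurable_V_past n k) (measurable_zetaV hmodel n k)).
  exact: ensemble_noise_law.
- apply: (cond_domZ Gm); first by have := M4; lra.
  apply: (forecast_dom (@measurable_U_past n) (measurable_zeta hmodel n)).
  exact: signal_noise_law.
- apply: (cond_domZ Gm) => //.
  exact: observation_noise_dom.
Qed.

Lemma posterior_cov_bound n : (1 <= n)%N ->
  {ae P, forall w, loewner_le (H *m post_cov (V n w) *m H^T) 1%:M}.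
Proof.
move=> n1; apply: filterS2 (hC n1) (hesrf n1) => w Cp asm.
exact: assimilation_post_cov asm.
Qed.

(** A pathwise bound, from the ball estimate and Jensen's inequality; the dependence of the gain on
    the noises is therefore harmless. *)
Lemma mean_energy_noisy n :
  {ae P, forall w, mean_energy H M (X n.+1 w) <= noisy_energy n w}.
Proof.
apply: filterS3 (hC (ltn0Sn n)) (hesrf (ltn0Sn n)) (signal_dynamics hmodel n).
move=> w Cp asm Uw; rewrite /mean_energy /noisy_energy /=.
have := assimilation_mean_le hK Cp asm; rewrite /observation Uw.
have := sqnorm_ens_mean_le H (forecast Psi V zetaV n.+1 w) (ltnW hK).
have -> : \sum_(k < K) sqnorm (H *m col k (forecast Psi V zetaV n.+1 w)) =
    \sum_(k < K) sqnorm (H *m (Psi (col k (V n w)) + zetaV n.+1 k w)).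
  by apply: eq_bigr => k _; rewrite forecast_col.
rewrite -ler_pdivlMl //.
have := sqnormD_le (H *m (Psi (U n w) + zeta n.+1 w)) (xi n.+1 w).
lra.
Qed.

Lemma ensemble_energy_noisy n :
  {ae P, forall w,
    ensemble_energy H M (X n.+1 w) <= K%:R * (noisy_energy n w + q%:R)}.
Proof.
apply: filterS2 (mean_energy_noisy n) (posterior_cov_bound (ltn0Sn n)).
move=> w Fw loe; rewrite /ensemble_energy /=.
have := sum_sqnorm_le (ltnW hK) loe.
have : K%:R * mean_energy H M (X n.+1 w) <= K%:R * noisy_energy n w.
  by rewrite ler_wpM2l // ltW.
rewrite /mean_energy /=; lra.
Qed.

Let predicted_energyE n w : predicted_energy n w =
  (1 - beta) * (K%:R^-1 * \sum_(k < K) sqnorm (H *m col k (V n w)))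
  + (2 + M) * (1 - beta) * sqnorm (H *m U n w)
  + ((3 + M) * K_h + 2 * q%:R).
Proof.
rewrite /predicted_energy big_split /= -mulr_sumr sumr_const card_ord.
rewrite -[K_h *+ K]mulr_natl mulrDr (mulrA _ K%:R K_h) mulVf ?gt_eqF // mul1r; ring.
Qed.

(** One [K_h] comes from the ensemble average and [2 + M] from the signal; [2 q] comes from the
    observation noise and one more [q] from the posterior spread. *)
Definition energy_excess : R := (3 + M) * K_h + 3 * q%:R.

Lemma energy_excess_gt0 : 0 < energy_excess.
Proof.
have q0 : 0 <= q%:R :> R by []; have := M4; have := hKh; rewrite /energy_excess; nra.
Qed.

Let contraction : (2 + M) * (1 - beta) <= (1 - beta / 2) * M.
Proof. by case/andP: hbeta => b0 b1; have := hM; lra. Qed.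

(** The energy of the members exceeds that of their mean by at most [q], but only once an
    assimilation has taken place: hence [1 <= n] here, and [2 <= n] in the drift of the mean. *)
Lemma predicted_mean_energy n : (1 <= n)%N ->
  {ae P, forall w, predicted_energy n w
    <= (1 - beta / 2) * mean_energy H M (X n w) + energy_excess}.
Proof.
move=> n1; apply: filterS (posterior_cov_bound n1) => w loe.
have := sum_sqnorm_le (ltnW hK) loe; rewrite -ler_pdivrMl // => le1.
rewrite predicted_energyE /mean_energy /energy_excess /=.
set s := _ * \sum_(k < K) _ in le1 *; set m := sqnorm _ in le1 *.
set u := sqnorm (H *m U n w).
have u0 : 0 <= u by exact: sqnorm_ge0.
have m0 : 0 <= m by exact: sqnorm_ge0.
have q0 : 0 <= q%:R :> R by [].
have uc := ler_wpM2r u0 contraction.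
case/andP: hbeta => b0 b1.
have : (1 - beta) * s <= (1 - beta) * (m + q%:R) by rewrite ler_wpM2l //; lra.
nra.
Qed.

(** The predicted energy is already expressed through the members, so no spread bound at time [n]
    enters and the estimate covers [n = 0]. *)
Lemma predicted_ensemble_energy n w :
  K%:R * (predicted_energy n w + q%:R)
  <= (1 - beta / 2) * ensemble_energy H M (X n w) + K%:R * energy_excess.
Proof.
rewrite predicted_energyE /ensemble_energy /energy_excess /=.
set s := \sum_(k < K) _; set u := sqnorm (H *m U n w).
have u0 : 0 <= K%:R * u by rewrite mulr_ge0 // ?sqnorm_ge0 // ltW.
have s0 : 0 <= s by apply: sumr_ge0 => k _; exact: sqnorm_ge0.
have uc := ler_wpM2r u0 contraction.
case/andP: hbeta => b0 b1.
have bs : 0 <= beta * s by rewrite mulr_ge0 // ltW.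
rewrite (_ : K%:R * _ = (1 - beta) * (K%:R * K%:R^-1 * s)
   + (2 + M) * (1 - beta) * (K%:R * u)
   + K%:R * ((3 + M) * K_h + 3 * q%:R)); last by ring.
rewrite divff ?gt_eqF // mul1r; lra.
Qed.

Lemma measurable_mean_energy_chain n :
  measurable_fun setT (fun w => mean_energy H M (X n w)).
Proof.
exact: (measurableT_comp (measurable_mean_energy H M) (measurable_chain hmodel n)).
Qed.

Lemma measurable_ensemble_energy :
  measurable_fun setT (ensemble_energy H M : borel (state R d K) -> R).
Proof.
by apply: measurable_real_continuous; exact: continuous_ensemble_energy.
Qed.

Lemma measurable_ensemble_energy_chain n :
  measurable_fun setT (fun w => ensemble_energy H M (X n w)).
Proof.
exact: (measurableT_comp measurable_ensemble_energy (measurable_chain hmodel n)).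
Qed.

Let M0 : 0 <= M. Proof. by have := M4; lra. Qed.

Let beta2 : 0 <= 1 - beta / 2.
Proof. by case/andP: hbeta => b0 b1; lra. Qed.

Lemma mean_energy_dom n : (1 <= n)%N ->
  cond_dom P (past X n) (fun w => mean_energy H M (X n.+1 w))
    (fun w => (1 - beta / 2) * mean_energy H M (X n w) + energy_excess).
Proof.
move=> n1; have Gm := @past_measurable n.
have dom := noisy_energy_dom n; have [mF mG F0 G0 _] := dom.
have e0 m w : 0 <= mean_energy H M (X m w) by exact: mean_energy_ge0.
apply: cond_dom_trans (cond_dom_trans dom _).
  apply: (cond_dom_ae Gm) => //; first exact: measurable_mean_energy_chain.
  exact: mean_energy_noisy.
apply: (cond_dom_ae Gm) => //.
- apply: measurable_funD => //; apply: measurable_funM => //.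
  exact: measurable_mean_energy_chain.
- by move=> w; rewrite addr_ge0 ?mulr_ge0 // ltW // energy_excess_gt0.
- exact: predicted_mean_energy.
Qed.

Lemma ensemble_energy_dom n :
  cond_dom P (past X n) (fun w => ensemble_energy H M (X n.+1 w))
    (fun w => (1 - beta / 2) * ensemble_energy H M (X n w) + K%:R * energy_excess).
Proof.
have Gm := @past_measurable n.
have e0 m w : 0 <= ensemble_energy H M (X m w) by exact: ensemble_energy_ge0.
have dom : cond_dom P (past X n) (fun w => K%:R * (noisy_energy n w + q%:R))
    (fun w => K%:R * (predicted_energy n w + q%:R)).
  apply: (cond_domZ Gm); first exact: ltW.
  by apply: (cond_domD Gm); [exact: noisy_energy_dom|exact: cond_dom_refl].
have [mF mG F0 G0 _] := dom.
apply: cond_dom_trans (cond_dom_trans dom _).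
  apply: (cond_dom_ae Gm) => //; first exact: measurable_ensemble_energy_chain.
  exact: ensemble_energy_noisy.
apply: (cond_dom_ae Gm) => //.
- apply: measurable_funD => //; apply: measurable_funM => //.
  exact: measurable_ensemble_energy_chain.
- by move=> w; rewrite addr_ge0 ?mulr_ge0 // ltW // energy_excess_gt0.
- by apply: aeW => w; exact: predicted_ensemble_energy.
Qed.

Lemma condexp_mean_energy n : (2 <= n)%N ->
  {ae P, forall w,
    (condexp P (past X n.-1) (fun w' => (mean_energy H M (X n w'))%:E) w
     <= ((1 - beta / 2) * mean_energy H M (X n.-1 w) + energy_excess)%:E)%E}.
Proof.
case: n => // n n1; have [mY _ Y0 W0 YW] := mean_energy_dom n1.
apply: (condexp_le (sigma_algebra_past n)
  (@past_measurable n)) => //.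
apply: measurable_funD => //; apply: measurable_funM => //.
exact: (measurableT_comp (measurable_mean_energy H M) (@measurable_chain_past n)).
Qed.

(** The comparison over events of the past contains the one over events of [X n], and the bound is a
    function of [X n]. *)
Lemma drift_ensemble_energy :
  drift_condition P X (ensemble_energy H M) (beta / 2) (K%:R * energy_excess).
Proof.
case=> // n _; have [mY _ Y0 W0 YW] := ensemble_energy_dom n.
have Gpast : sigma_of (X n) `<=` past X n.
  by move=> A XA; apply: sub_sigma_algebra; exists n => /=.
apply: condexp_le => //.
- by apply: sigma_algebra_preimage; exact: sigma_algebra_measurable.
- by apply: subset_trans Gpast _; exact: past_measurable.
- apply: measurable_funD => //; apply: measurable_funM => //.
  have mX : measurable_fun setT
      (X n : g_sigma_algebraType (sigma_of (X n)) -> borel (state R d K)).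
    move=> _ B mB; apply: sub_sigma_algebra; exists B => //.
  exact: (measurableT_comp measurable_ensemble_energy mX).
- by move=> A /Gpast; exact: YW.
Qed.

(** * Uniform bounds on expectations *)

Let KM1 : 1 <= K%:R * M.
Proof.
have K1 : 1 <= K%:R :> R by rewrite ler1n ltnW.
have := M4; nra.
Qed.

Let KD0 : 0 < K%:R * energy_excess.
Proof. by rewrite mulr_gt0 // energy_excess_gt0. Qed.

Let ens_ge0 n w : 0 <= ensemble_energy H M (X n w).
Proof. exact: ensemble_energy_ge0. Qed.

Lemma beta_half : 0 < beta / 2 < 1.
Proof. by case/andP: hbeta => b0 b1; apply/andP; split; lra. Qed.

(** The whole space is an event of the past, so the conditional comparison can be integrated without
    assuming finite energy. *)
Lemma expected_energy_step n :
  ('E_P[fun w => ensemble_energy H M (X n.+1 w)] <=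
   (1 - beta / 2)%:E * 'E_P[fun w => ensemble_energy H M (X n w)]
     + (K%:R * energy_excess)%:E)%E.
Proof.
have [mY mW Y0 W0 /(_ setT)] := ensemble_energy_dom n.
have pT : past X n setT by exact: (@measurableT _ (g_sigma_algebraType _)).
move=> /(_ pT) YW; rewrite unlock; apply: (le_trans YW).
under eq_integral do rewrite EFinD EFinM.
rewrite ge0_integralD //.
- rewrite ge0_integralZl //.
  + rewrite -[X in (_ + X)%E]/(\int[P]_w cst (K%:R * energy_excess)%:E w)%E.
    by rewrite integral_cst // [X in (_ + _ * X)%E]probability_setT mule1.
  + exact/measurable_EFinP/measurable_ensemble_energy_chain.
  + by move=> w _; rewrite lee_fin.
- by move=> w _; rewrite mule_ge0 ?lee_fin.
- apply: emeasurable_funM => //.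
  exact/measurable_EFinP/measurable_ensemble_energy_chain.
- by move=> w _; rewrite lee_fin ltW.
Qed.

Lemma expected_energy_bound n :
  ('E_P[fun w => ensemble_energy H M (X n w)] <=
   ((1 - beta / 2) ^+ n)%:E * 'E_P[fun w => ensemble_energy H M (X 0%N w)]
     + (K%:R * energy_excess / (beta / 2))%:E)%E.
Proof.
apply: (gronwall_ereal
  (e := fun n => 'E_P[fun w => ensemble_energy H M (X n w)]%E)) => // [|m|m].
- exact: beta_half.
- by rewrite unlock; apply: integral_ge0 => w _; rewrite lee_fin.
- exact: expected_energy_step.
Qed.

Let E0_ge0 n : (0 <= 'E_P[fun w => ensemble_energy H M (X n w)])%E.
Proof. by rewrite unlock; apply: integral_ge0 => w _; rewrite lee_fin. Qed.

Lemma E_bounded_ensemble_energy :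
  ('E_P[fun w => ensemble_energy H M (X 0%N w)] < +oo)%E ->
  E_bounded P X (ensemble_energy H M).
Proof.
move=> E0; set e0 := ('E_P[_])%E in E0.
have e0fin : e0 \is a fin_num by rewrite ge0_fin_numE //; exact: E0_ge0.
exists (fine e0 + K%:R * energy_excess / (beta / 2)) => n.
apply: (le_trans (expected_energy_bound n)).
rewrite EFinD fineK // leeD2r // -[leRHS]mul1e lee_wpmul2r //.
rewrite lee_fin exprn_ile1 // gerBl; case/andP: hbeta => b0 _; lra.
Qed.

Let total_sqnorm n w := sqnorm (U n w) + \sum_(k < K) sqnorm (col k (V n w)).

Let total_sqnorm_ge0 n w : 0 <= total_sqnorm n w.
Proof.
by rewrite addr_ge0 ?sqnorm_ge0 // sumr_ge0 // => k _; exact: sqnorm_ge0.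
Qed.

Let measurable_sqnorm_U n : measurable_fun setT (fun w => sqnorm (U n w)).
Proof.
rewrite (_ : (fun w => _) = (fun w => sqnorm (1%:M *m U n w))); last first.
  by apply/funext => w; rewrite mul1mx.
apply: measurable_sqnorm_mulmx => i.
exact: (measurableT_comp (@measurable_coord d 1 i 0)
  (measurable_sub_sigma (sigma_algebra_past n)
    (@past_measurable n) (@measurable_U_past n))).
Qed.

Let measurable_sqnorm_V n k :
  measurable_fun setT (fun w => sqnorm (col k (V n w))).
Proof.
rewrite (_ : (fun w => _) = (fun w => sqnorm (1%:M *m col k (V n w)))); last first.
  by apply/funext => w; rewrite mul1mx.
apply: measurable_sqnorm_mulmx => i.
exact: (measurableT_comp (@measurable_coord d 1 i 0)
  (measurable_sub_sigma (sigma_algebra_past n)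
    (@past_measurable n) (@measurable_V_past n k))).
Qed.

Let measurable_total_sqnorm n : measurable_fun setT (total_sqnorm n).
Proof. by apply: measurable_funD => //; apply: measurable_sum. Qed.

(** As a single integral, the second moment can be compared with the energy pointwise. *)
Lemma second_momentE n :
  second_moment P U V n = (\int[P]_w (total_sqnorm n w)%:E)%E.
Proof.
rewrite /second_moment unlock /total_sqnorm.
transitivity (\int[P]_w ((sqnorm (U n w))%:E
    + \sum_(k < K) (sqnorm (col k (V n w)))%:E))%E; last first.
  by apply: eq_integral => w _; rewrite sumEFin.
rewrite ge0_integralD //.
- rewrite ge0_integral_sum //.
  + by move=> k; exact/measurable_EFinP.
  + by move=> k w _; rewrite lee_fin sqnorm_ge0.
- by move=> w _; rewrite lee_fin sqnorm_ge0.
- exact/measurable_EFinP.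
- by move=> w _; rewrite sume_ge0 // => k _; rewrite lee_fin sqnorm_ge0.
- by apply: emeasurable_sum => k; exact/measurable_EFinP.
Qed.

Let integral_leZ (a : R) (f g : T -> R) : 0 <= a ->
  measurable_fun setT f -> measurable_fun setT g ->
  (forall w, 0 <= f w) -> (forall w, 0 <= g w) -> (forall w, f w <= a * g w) ->
  (\int[P]_w (f w)%:E <= a%:E * \int[P]_w (g w)%:E)%E.
Proof.
move=> a0 mf mg f0 g0 fg; rewrite -ge0_integralZl //.
- apply: ge0_le_integral => //.
  + by move=> w _; rewrite lee_fin.
  + exact/measurable_EFinP.
  + by apply: emeasurable_funM => //; exact/measurable_EFinP.
  + by move=> w _; rewrite -EFinM lee_fin.
- exact/measurable_EFinP.
- by move=> w _; rewrite lee_fin.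
Qed.

Lemma second_moment_finite_energy n : (second_moment P U V n < +oo)%E ->
  ('E_P[fun w => ensemble_energy H M (X n w)] < +oo)%E.
Proof.
have [b b0 bH] := sqnorm_mulmx_le H.
rewrite second_momentE unlock => fin.
(* The factor [b K M] serves for both the signal and the members, since [K M >= 1]. *)
apply: (@le_lt_trans _ _
    ((b * (K%:R * M))%:E * \int[P]_w (total_sqnorm n w)%:E)%E); last first.
  by rewrite lte_mul_pinfty // ?lee_fin ?mulr_ge0 // ltW.
apply: integral_leZ => //; first by rewrite !mulr_ge0 // ltW.
  exact: measurable_ensemble_energy_chain.
move=> w; rewrite /ensemble_energy /total_sqnorm /=.
have hU := bH (U n w).
have hV : \sum_(k < K) sqnorm (H *m col k (V n w)) <=
    b * \sum_(k < K) sqnorm (col k (V n w)).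
  by rewrite mulr_sumr; apply: ler_sum => k _; exact: bH.
have v0 : 0 <= \sum_(k < K) sqnorm (col k (V n w)).
  by apply: sumr_ge0 => k _; exact: sqnorm_ge0.
have bv0 := mulr_ge0 (ltW b0) v0.
have hV' := ler_peMl bv0 KM1.
have hU' := ler_wpM2l (le_trans ler01 KM1) hU.
lra.
Qed.

Lemma lyapunov_ensemble_energy : lyapunov P X (ensemble_energy H M).
Proof.
split; first by move=> x; exact: ensemble_energy_ge0.
exists (beta / 2), (K%:R * energy_excess).
by split; [exact: beta_half|exact: KD0|exact: drift_ensemble_energy].
Qed.

(** * Full observation: the energy controls the state *)

Section FullRank.
Hypothesis rankH : \rank H = d.

Lemma second_moment_le_energy :
  exists2 a : R, 0 < a & forall n, (second_moment P U V n <=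
    a%:E * 'E_P[fun w => ensemble_energy H M (X n w)])%E.
Proof.
have [a a0 aH] := exists_sqnorm_le_obs rankH; exists a => // n.
rewrite second_momentE unlock; apply: integral_leZ => //; first exact: ltW.
  exact: measurable_ensemble_energy_chain.
move=> w; rewrite /ensemble_energy /total_sqnorm /= mulrDr addrC lerD //.
  by rewrite mulr_sumr; apply: ler_sum => k _; exact: aH.
apply: (le_trans (aH _)); rewrite ler_pM2l //.
by rewrite ler_peMl // sqnorm_ge0.
Qed.

Lemma second_moment_bound : exists2 a : R, 0 < a &
  forall n, (second_moment P U V n <= a%:E * (((1 - beta / 2) ^+ n)%:E *
    'E_P[fun w => ensemble_energy H M (X 0%N w)]
    + (K%:R * energy_excess / (beta / 2))%:E))%E.
Proof.
have [a a0 aE] := second_moment_le_energy; exists a => // n.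
apply: (le_trans (aE n)); rewrite lee_wpmul2l ?lee_fin ?(ltW a0) //.
exact: expected_energy_bound.
Qed.

Lemma second_moment_uniform : (second_moment P U V 0 < +oo)%E ->
  exists B : R, forall n, (second_moment P U V n <= B%:E)%E.
Proof.
move=> /second_moment_finite_energy/E_bounded_ensemble_energy[B EB].
have [a a0 aE] := second_moment_le_energy; exists (a * B) => n.
apply: (le_trans (aE n)); rewrite EFinM.
by rewrite lee_wpmul2l ?lee_fin ?(ltW a0).
Qed.

Lemma strong_lyapunov_ensemble_energy :
  strong_lyapunov P X (ensemble_energy H M).
Proof.
split; first exact: lyapunov_ensemble_energy.
by move=> b; exact: compact_ensemble_energy.
Qed.

End FullRank.

End Model.

Lemma observable_stability_esrf (R : realType) (disp : measure_display)
    (T : measurableType disp) (P : probability T R)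
    (d q K : nat) (H : 'M[R]_(q, d))
    (Psi : 'cV[R]_d -> 'cV[R]_d) (Rh : 'cV[R]_d -> 'M[R]_d)
    (law : nat -> R.-pker (borel 'cV[R]_d) ~> (borel 'cV[R]_d))
    (law_xi : probability (borel 'cV[R]_q) R)
    (U : nat -> T -> 'cV[R]_d) (V : nat -> T -> 'M[R]_(d, K))
    (zeta : nat -> T -> 'cV[R]_d) (zetaV : nat -> 'I_K -> T -> 'cV[R]_d)
    (xi : nat -> T -> 'cV[R]_q) (kind : esrf_kind) (beta K_h : R)
    (C : nat -> T -> 'M[R]_d) :
  (2 <= K)%N ->
  signal_noise_model P Psi Rh law law_xi U V zeta zetaV xi ->
  0 < beta < 1 -> 0 < K_h -> observable_energy_criterion H Psi Rh beta K_h ->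
  (forall n, (1 <= n)%N -> {ae P, forall w, psd (C n w)}) ->
  esrf P H kind Psi C U V zetaV xi ->
  observable_stability P H beta U V.
Proof.
move=> hK hmodel hbeta hKh henergy hC hesrf X.
have b0 : 0 < beta by case/andP: hbeta.
(* The least weight satisfying [4 <= beta M]. *)
pose M := 4 / beta.
have hM : 4 <= beta * M by rewrite /M mulrC divfK // gt_eqF.
split; first exact: (posterior_cov_bound hK hC hesrf).
have D0 := energy_excess_gt0 q hbeta hKh hM.
exists (energy_excess q K_h M), M; split => //.
- by rewrite divr_gt0.
- exact: (condexp_mean_energy hmodel hbeta hKh henergy hK hC hesrf hM).
- split; first exact: (lyapunov_ensemble_energy hmodel hbeta hKh henergy hK hC hesrf hM).
  exact: (E_bounded_ensemble_energy hmodel hbeta hKh henergy hK hC hesrf hM).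
move=> rankH; split.
- exact: (strong_lyapunov_ensemble_energy hmodel hbeta hKh henergy hK hC hesrf hM rankH).
- exact: (second_moment_uniform hmodel hbeta hKh henergy hK hC hesrf hM rankH).
have [a a0 aB] := second_moment_bound hmodel hbeta hKh henergy hK hC hesrf hM rankH.
exists a, (beta / 2), (K%:R * energy_excess q K_h M); split => //.
- exact: beta_half.
- by rewrite mulr_gt0 // ltr0n ltnW.
- exact: (drift_ensemble_energy hmodel hbeta hKh henergy hK hC hesrf hM).
Qed.

Theorem theorem3p3 (R : realType) (disp : measure_display)
    (T : measurableType disp) (P : probability T R)
    (d q K : nat) (hq : (1 <= q)%N) (hqd : (q <= d)%N) (hK : (2 <= K)%N)
    (H : 'M[R]_(q, d)) (hH : \rank H = q)
    (Psi : 'cV[R]_d -> 'cV[R]_d) (Rh : 'cV[R]_d -> 'M[R]_d)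
    (law : nat -> R.-pker (borel 'cV[R]_d) ~> (borel 'cV[R]_d))
    (law_xi : probability (borel 'cV[R]_q) R)
    (U : nat -> T -> 'cV[R]_d) (V : nat -> T -> 'M[R]_(d, K))
    (zeta : nat -> T -> 'cV[R]_d) (zetaV : nat -> 'I_K -> T -> 'cV[R]_d)
    (xi : nat -> T -> 'cV[R]_q)
    (hmodel : signal_noise_model P Psi Rh law law_xi U V zeta zetaV xi)
    (kind : esrf_kind)
    (beta_h K_h : R) (hbeta : 0 < beta_h < 1) (hKh : 0 < K_h)
    (henergy : observable_energy_criterion H Psi Rh beta_h K_h) :
  let Chat n w := sample_cov (forecast Psi V zetaV n w) in
  [/\ esrf P H kind Psi Chat U V zetaV xi ->
        observable_stability P H beta_h U V,
      forall C : nat -> T -> 'M[R]_d,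
        (forall n, (1 <= n)%N -> {ae P, forall w, psd (C n w)}) ->
        esrf P H kind Psi C U V zetaV xi ->
        observable_stability P H beta_h U V &
      forall lambda : R, 0 < lambda ->
        esrf P H kind Psi (fun n w => (1 + lambda) *: Chat n w) U V zetaV xi ->
        observable_stability P H beta_h U V].
Proof.
(* Sample covariances are scaled Gram matrices, and inflation multiplies them by a positive factor,
   so all three claims are instances of the result for arbitrary positive semi-definite [C]. *)
move=> Chat; have psdChat n w : psd (Chat n w) by exact: psd_sample_cov.
have stab := observable_stability_esrf hK hmodel hbeta hKh henergy.
split=> [hC|C psdC hC|lambda lambda0 hC].
- by apply: stab hC => n _; apply: aeW => w; exact: psdChat.
- exact: stab psdC hC.
- apply: stab hC => n _; apply: aeW => w; apply: psdZ (psdChat n w).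
  by rewrite addr_ge0 // ltW.
Qed.
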